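(* Let $f:(0,\infty)\to\mathbb{R}$ be a convex function and let $\varphi:\mathbb{R}^n\to[0,\infty)$ be a log-concave function, $\varphi$ and $f$ satisfying the standing regularity and integrability assumptions listed in the context. Then $$\int_{\mathrm{supp}(\varphi)} \varphi\, f\!\left( e^{\frac{\langle \nabla\varphi,x\rangle}{\varphi}}\,\varphi^{-2}\,\det\left(\mathrm{Hess}(-\ln\varphi)\right)\right)dx \ \ge\ f\!\left(\frac{\int \varphi^\circ\,dx}{\int\varphi\,dx}\right)\left(\int_{\mathrm{supp}(\varphi)}\varphi\,dx\right).$$ If instead $f$ is concave, the inequality is reversed. If $f$ is linear, equality holds. Equality also holds if $\varphi(x)=Ce^{-\langle Ax,x\rangle}$, where $C$ is a positive constant and $A$ is an $n\times n$ positive definite matrix.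
   Context: A function $\varphi:\mathbb{R}^n\to[0,\infty)$ is log-concave if $\varphi=e^{-\psi}$ with $\psi:\mathbb{R}^n\to\mathbb{R}$ convex; $\mathrm{supp}(\varphi)=\{x:\varphi(x)>0\}$. $\nabla$ is the gradient and $\mathrm{Hess}$ the Hessian matrix. The dual function of $\varphi$ is $\varphi^\circ(x)=\inf_{y\in\mathbb{R}^n}\frac{e^{-\langle x,y\rangle}}{\varphi(y)}$ (so $\varphi^\circ=e^{-\mathcal{L}\psi}$ with $\mathcal{L}\psi(x)=\sup_y[\langle x,y\rangle-\psi(y)]$). Convention: $f(0)=\lim_{t\downarrow0}f(t)$ and $0\cdot\infty=0$. Standing assumptions: $\psi=-\ln\varphi$ is strictly convex, $\varphi\in C^2(\mathrm{supp}(\varphi))\cap L^1(\mathbb{R}^n,dx)$, $\varphi^\circ\in L^1(\mathrm{supp}(\varphi),dx)$, and $\varphi\, f\big(e^{\langle\nabla\varphi,x\rangle/\varphi}\varphi^{-2}\det(\mathrm{Hess}(-\ln\varphi))\big)\in L^1(\mathrm{supp}(\varphi),dx)$. *)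

(* Defs.v *)
From HB Require Import structures.
From mathcomp Require Import all_boot all_order all_algebra.
From mathcomp Require Import all_classical all_reals all_analysis.

Set Implicit Arguments.
Unset Strict Implicit.
Unset Printing Implicit Defensive.

Import Order.TTheory GRing.Theory Num.Theory.
Import numFieldNormedType.Exports.

Local Open Scope classical_set_scope.
Local Open Scope ring_scope.

Definition rV_display : measure_display. Proof. exact: default_measure_display. Qed.

Section rV_measurable.
Context {R : realType} (n : nat).

Let coors : 'I_n -> 'rV[R]_n -> measurableTypeR R := fun i v => v 0 i.

Let rV_set0 : g_sigma_preimage coors set0.
Proof. exact: sigma_algebra0. Qed.

Let rV_setC A : g_sigma_preimage coors A -> g_sigma_preimage coors (~` A).
Proof. exact: sigma_algebraC. Qed.

Let rV_bigcup (F : _^nat) : (forall i, g_sigma_preimage coors (F i)) ->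
  g_sigma_preimage coors (\bigcup_i (F i)).
Proof. exact: sigma_algebra_bigcup. Qed.

(* The sigma-algebra generated by the coordinates, i.e., the Borel sets. *)
HB.instance Definition _ := @isMeasurable.Build rV_display
  'rV[R]_n (g_sigma_preimage coors) rV_set0 rV_setC rV_bigcup.

Lemma measurable_coord (i : 'I_n) :
  measurable_fun [set: 'rV[R]_n] (fun v => v 0 i : measurableTypeR R).
Proof.
move=> _ Y mY; rewrite setTI; apply: sub_sigma_algebra => /=.
rewrite -bigcup_seq/=; exists i => /=; first by rewrite mem_index_enum.
by exists Y => //; rewrite setTI.
Qed.

Lemma measurable_fun_rV d (T : measurableType d) (f : T -> 'rV[R]_n) :
  (forall i, measurable_fun [set: T] (fun x => f x 0 i : measurableTypeR R)) ->
  measurable_fun [set: T] f.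
Proof.
move=> mf.
have H : preimage_set_system [set: T] f (g_sigma_preimage coors) `<=` measurable.
  rewrite -g_sigma_preimage_comp; apply: smallest_sub.
    exact: sigma_algebra_measurable.
  rewrite -bigcup_seq; apply: bigcup_sub => i _ A [B mB <-].
  exact: mf.
by move=> _ A mA; apply: H; exists A.
Qed.

End rV_measurable.

Section lebesgue_rV.
Context {R : realType}.

Definition rV_cons n (xv : measurableTypeR R * 'rV[R]_n) : 'rV[R]_n.+1 :=
  row_mx (xv.1)%:M xv.2 : 'rV_(1 + n).

Definition rV_uncons n (v : 'rV[R]_n.+1) : measurableTypeR R * 'rV[R]_n :=
  (v 0 0, rsubmx (v : 'rV_(1 + n))).

Lemma rV_cons0 n (xv : measurableTypeR R * 'rV[R]_n) : rV_cons xv 0 0 = xv.1.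
Proof.
transitivity (row_mx (xv.1)%:M xv.2 0 (lshift n 0)).
  by congr (row_mx _ _ _ _); exact/val_inj.
by rewrite row_mxEl mxE eqxx.
Qed.

Lemma rV_consS n (xv : measurableTypeR R * 'rV[R]_n) i :
  rV_cons xv 0 (lift 0 i) = xv.2 0 i.
Proof.
transitivity (row_mx (xv.1)%:M xv.2 0 (rshift 1 i)).
  by congr (row_mx _ _ _ _); exact/val_inj.
by rewrite row_mxEr.
Qed.

Lemma rV_consK n : cancel (@rV_cons n) (@rV_uncons n).
Proof.
by move=> [x v]; rewrite /rV_uncons rV_cons0 /rV_cons row_mxKr.
Qed.

Lemma measurable_rV_cons n : measurable_fun setT (@rV_cons n).
Proof.
apply: measurable_fun_rV => i.
have [->|[j ->]] : i = 0 \/ exists j, i = lift 0 j.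
- by case: (unliftP 0 i) => [j ->|->]; [right; exists j|left].
- by under eq_fun do rewrite rV_cons0; exact: measurable_fst.
- under eq_fun do rewrite rV_consS.
  exact: (measurableT_comp (measurable_coord j) measurable_snd).
Qed.

Lemma measurable_rV_uncons n : measurable_fun setT (@rV_uncons n).
Proof.
apply/measurable_fun_pairP; split; first exact: measurable_coord.
apply: measurable_fun_rV => i /=.
under eq_fun do rewrite mxE.
exact: measurable_coord.
Qed.

Section step.
Context (n : nat) (mu : {sigma_finite_measure set 'rV[R]_n -> \bar R}).

Definition lebesgue_rV_step : set 'rV[R]_n.+1 -> \bar R :=
  pushforward (@lebesgue_measure R \x mu)%E (@rV_cons n).

Let step0 : lebesgue_rV_step set0 = 0%E.
Proof. by rewrite /lebesgue_rV_step /pushforward preimage_set0 measure0. Qed.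

Let step_ge0 A : (0 <= lebesgue_rV_step A)%E.
Proof. by rewrite /lebesgue_rV_step /pushforward measure_ge0. Qed.

Let step_sigma_additive : semi_sigma_additive lebesgue_rV_step.
Proof.
have mf := @measurable_rV_cons n; rewrite /lebesgue_rV_step.
exact: measure_semi_sigma_additive.
Qed.

HB.instance Definition _ := isMeasure.Build _ _ _ lebesgue_rV_step
  step0 step_ge0 step_sigma_additive.

Lemma lebesgue_rV_stepX (A : set (measurableTypeR R)) (B : set 'rV[R]_n) :
  measurable A -> measurable B ->
  lebesgue_rV_step (@rV_uncons n @^-1` (A `*` B)) =
    (@lebesgue_measure R A * mu B)%E.
Proof.
move=> mA mB; rewrite /lebesgue_rV_step /pushforward -comp_preimage.
rewrite (_ : _ \o _ = id) ?preimage_id ?product_measure1E//.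
by apply/funext => x; exact: rV_consK.
Qed.

Let sigma_finite_step : sigma_finite setT lebesgue_rV_step.
Proof.
have /sigma_finiteP[F [TF ndF Foo]] := sigma_finiteT (@lebesgue_measure R).
have /sigma_finiteP[G [TG ndG Goo]] := sigma_finiteT mu.
exists (fun k => @rV_uncons n @^-1` (F k `*` G k)).
  rewrite -preimage_bigcup (_ : \bigcup_k _ = setT) ?preimage_setT//.
  apply/seteqP; split=> // -[x v] _.
  have [i _ Fx] : (\bigcup_k F k) x by rewrite -TF.
  have [j _ Gv] : (\bigcup_k G k) v by rewrite -TG.
  exists (maxn i j) => //; split => /=.
  - by move: x Fx; exact/subsetPset/ndF/leq_maxl.
  - by move: v Gv; exact/subsetPset/ndG/leq_maxr.
move=> k; have [mF Fk] := Foo k; have [mG Gk] := Goo k; split.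
  rewrite -[X in measurable X]setTI; apply: measurable_rV_uncons => //.
  exact: measurableX.
by rewrite lebesgue_rV_stepX// lte_mul_pinfty// ge0_fin_numE.
Qed.

HB.instance Definition _ :=
  Measure_isSigmaFinite.Build _ _ _ lebesgue_rV_step sigma_finite_step.

End step.

(* Lebesgue measure on R^n: on R^0 the unit mass, and on R^(n+1) the product of
   the Lebesgue measures on R and on R^n. *)
Fixpoint lebesgue_rV n : {sigma_finite_measure set 'rV[R]_n -> \bar R} :=
  match n with
  | 0%N => \d_(0 : 'rV[R]_0)
  | m.+1 => lebesgue_rV_step (lebesgue_rV m)
  end.

Lemma lebesgue_rV_box n (A : 'I_n -> set (measurableTypeR R)) :
  (forall i, measurable (A i)) ->
  lebesgue_rV n [set v | forall i, A i (v 0 i)] =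
    (\prod_(i < n) lebesgue_measure (A i))%E.
Proof.
elim: n A => [|n IH] A mA.
  by rewrite big_ord0 /= diracE mem_set// => -[].
rewrite big_ord_recl -IH// -lebesgue_rV_stepX//=.
- congr lebesgue_rV_step; apply/seteqP; split=> v /=.
  + move=> Av; split=> [|i]; first exact: Av.
    rewrite mxE; have := Av (lift 0 i).
    by congr (A _ (v 0 _)); exact/val_inj.
  + move=> [A0 AS] i; have [->//|[j ->]] : i = 0 \/ exists j, i = lift 0 j.
      by case: (unliftP 0 i) => [j ->|->]; [right; exists j|left].
    have := AS j; rewrite mxE.
    by congr (A _ (v 0 _)); exact/val_inj.
- rewrite (_ : (fun _ => _) =
    \bigcap_(i in [set: 'I_n]) ((fun v : 'rV[R]_n => v 0 i) @^-1` A (lift 0 i))).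
    apply: fin_bigcap_measurable => // i _; rewrite -[X in measurable X]setTI.
    exact: measurable_coord.
  by apply/seteqP; split => [v Av i _|v Av i]; [exact: Av|exact: Av].
Qed.

End lebesgue_rV.

Section euclidean.
Context {R : realType} {n : nat}.
Implicit Types (phi psi : 'rV[R]_n -> R) (x y : 'rV[R]_n) (A : 'M[R]_n).

Definition dot x y : R := \sum_(i < n) x 0 i * y 0 i.

(* [x *m A^T] is the row vector of the product of A with the column vector x. *)
Definition quad_form A x : R := dot (x *m A^T) x.

Definition posdefmx A := forall x, x != 0 -> 0 < quad_form A x.

Definition partial (i : 'I_n) psi x : R := 'D_(delta_mx 0 i) psi x.

Definition grad psi x : 'rV[R]_n := \row_i partial i psi x.

Definition Hess psi x : 'M[R]_n := \matrix_(i, j) partial j (partial i psi) x.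

(* D is meant to be open. *)
Definition C2_on (D : set 'rV[R]_n) psi := forall x, D x ->
  {for x, continuous psi} /\
  forall i, [/\ derivable psi x (delta_mx 0 i),
    {for x, continuous (partial i psi)} &
    forall j, derivable (partial i psi) x (delta_mx 0 j) /\
              {for x, continuous (partial j (partial i psi))}].

Definition strictly_convex psi := forall (t : R) x y, 0 < t < 1 -> x != y ->
  psi (t *: x + (1 - t) *: y) < t * psi x + (1 - t) * psi y.

(* As psi is finite, phi is positive everywhere. *)
Definition log_concave phi := exists2 psi : 'rV[R]_n -> R,
  convex_function [set: 'rV[R]_n] psi & forall x, phi x = expR (- psi x).

Definition supp phi : set 'rV[R]_n := [set x | 0 < phi x].

(* For a positive phi this set is bounded below by 0, so that [inf] is its
   infimum. *)
Definition dual phi x : R :=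
  inf [set expR (- dot x y) / phi y | y in [set: 'rV[R]_n]].

Definition div_arg phi x : R :=
  expR (dot (grad phi x) x / phi x) * phi x ^- 2 *
  \det (Hess (fun y => - ln (phi y)) x).

End euclidean.

(* A function f on ]0, +oo[ extended at 0 by its right limit, which may be
   infinite; only nonnegative arguments matter. *)
Definition ext0 (R : realType) (f : R -> R) (t : R) : \bar R :=
  if t == 0 then lim ((f s)%:E @[s --> 0^'+]) else (f t)%:E.

Definition div_integrand (R : realType) n (f : R -> R) (phi : 'rV[R]_n -> R)
  (x : 'rV[R]_n) : \bar R := ((phi x)%:E * ext0 f (div_arg phi x))%E.

(* Main.v *)
From HB Require Import structures.
Require Import Defs.
From mathcomp Require Import all_boot all_order all_algebra.
From mathcomp Require Import all_classical all_reals all_analysis.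
From mathcomp Require Import perm measurable_realfun zify ring lra.

Set Implicit Arguments.
Unset Strict Implicit.
Unset Printing Implicit Defensive.

Import Order.TTheory GRing.Theory Num.Theory.
Import numFieldNormedType.Exports.

Local Open Scope classical_set_scope.
Local Open Scope ring_scope.

(** Write phi = exp (- psi) with psi finite, strictly convex and C^2, so that
the support of phi is the whole space. With g = grad psi and H = Hess psi,

  phi x * div_arg phi x = exp (psi x - <g x, x>) * det (H x),

and exp (psi x - <g x, x>) is the value of the dual function at the point g x.
Formally the substitution y = g x therefore gives the identity

  \int phi * div_arg phi = \int dual phi             (integral_div_arg),

and the inequality is Jensen's inequality for f, the values of div_arg phi and
the probability density phi / \int phi (jensen_ext0). The concave case is the
convex case of - f, an affine f is both convex and concave, and for a Gaussian
phi the function div_arg phi is constant, so that the identity forces the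
constant to be the quotient of the two integrals.

The work is in the identity: H may be singular, and g need not be onto. It
rests on two results.

Change of variables (ge0_change_of_variables) holds for C^1 maps T that are
strongly monotone, c |x - y|^2 <= <T x - T y, x - y> with c > 0. The proof is
by induction on the dimension. Split T = (T_0, T') and x = (a, v), and solve
T_0 (u, v) = p for u = u (p, v). For fixed p the map v |-> T' (u (p, v), v) is
again strongly monotone with the same constant, one dimension lower, and its
Jacobian matrix is the Schur complement of the first diagonal entry in the
Jacobian matrix of T. Tonelli's theorem and the substitution p = T_0 (a, v) on
the line conclude.

Regularization: psi_e = psi + e |x|^2 / 2 has a strongly monotone gradient, so
the identity holds for psi_e and e > 0. On the dual side the limit e -> 0 is
dominated, because psi is finite everywhere and its dual function therefore
decays faster than any exponential. On the other side Fatou's lemma gives one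
inequality (reg_pullback_fatou). For the opposite one no mass may escape to
infinity. Let I_e be the integral of the dual function of psi_e. Dilating that
function about g 0 by a factor t > 1 divides I_e by t^n, while after
substitution it multiplies the integrand by at most exp (- (t - 1) <g x - g 0,
x>). By strict convexity <g x - g 0, x> grows at least linearly, so this weight
is small outside a large box; in the limit e -> 0 the bound reads I_0 <= t^n (J
+ small * I_0) with J the integral over the box, and t -> 1 yields I_0 <= \int
phi * div_arg phi (integral_dual_bound, integral_dual_eq_pullback). *)

(** * Scalar product, topology and Borel sets of row vectors *)

Section dot.
Context {R : realType} (n : nat).
Implicit Types x y z v w : 'rV[R]_n.

Lemma dotC x y : dot x y = dot y x.
Proof. by apply: eq_bigr => i _; rewrite mulrC. Qed.

Lemma dotDl x y z : dot (x + y) z = dot x z + dot y z.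
Proof. by rewrite /dot -big_split; apply: eq_bigr => i _;
  rewrite mxE mulrDl. Qed.

Lemma dotNl x z : dot (- x) z = - dot x z.
Proof. by rewrite /dot -sumrN; apply: eq_bigr => i _; rewrite mxE mulNr. Qed.

Lemma dotBl x y z : dot (x - y) z = dot x z - dot y z.
Proof. by rewrite dotDl dotNl. Qed.

Lemma dot_ge0 x : 0 <= dot x x.
Proof. by apply: sumr_ge0 => i _; rewrite -expr2 sqr_ge0. Qed.

Lemma dotZr x y k : dot x (k *: y) = k * dot x y.
Proof. by rewrite /dot mulr_sumr; apply: eq_bigr => i _;
  rewrite mxE mulrCA. Qed.

Lemma dot_delta x i : dot x (delta_mx 0 i) = x 0 i.
Proof.
rewrite /dot (bigD1 i)//= mxE !eqxx mulr1 big1 ?addr0// => j ji.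
by rewrite mxE (negbTE ji) andbF mulr0.
Qed.

Lemma dotZl k x z : dot (k *: x) z = k * dot x z.
Proof. by rewrite dotC dotZr dotC. Qed.

Lemma dotDr z x y : dot z (x + y) = dot z x + dot z y.
Proof. by rewrite dotC dotDl !(dotC z). Qed.

Lemma dotBr z x y : dot z (x - y) = dot z x - dot z y.
Proof. by rewrite dotC dotBl !(dotC z). Qed.

Lemma dot_mulmx x y (B : 'M[R]_n) : dot (y *m B) x = dot y (x *m B^T).
Proof.
have dotE v w : dot v w = (v *m w^T) 0 0.
  by rewrite mxE; apply: eq_bigr => i _; rewrite mxE.
by rewrite !dotE trmx_mul trmxK mulmxA.
Qed.

End dot.

Section real_functions.
Context {R : realType}.

Lemma cvg_expR (T : Type) (F : set_system T) (FF : Filter F) (f : T -> R) a :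
  f @ F --> a -> expR (f t) @[t --> F] --> expR a.
Proof. by move=> fa; exact: (cvg_comp _ _ fa (@continuous_expR R a)). Qed.

Lemma is_derive_continuous (f df : R -> R) :
  (forall x : R, is_derive x (1 : R) f (df x)) -> continuous f.
Proof.
move=> fP x; apply/differentiable_continuous/derivable1_diffP.
exact: (@ex_derive _ _ _ _ _ _ _ (fP x)).
Qed.

End real_functions.

Section rV_topology.
Context {R : realType}.

Lemma cvg_rV (T : Type) (F : set_system T) (FF : Filter F) n
    (f : T -> 'rV[R]_n) (a : 'rV[R]_n) :
  (forall i, (fun t => f t 0 i) @ F --> a 0 i) -> f @ F --> a.
Proof.
move=> fa; apply/cvg_ballP => e e0.
have : \forall t \near F, forall i : 'I_n, ball (a 0 i) e (f t 0 i).
  apply: filter_forall => i.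
  by move/cvg_ballP : (fa i); apply.
apply: filterS => t ft; split => // i j; rewrite (ord1 i); exact: ft.
Qed.

(** The neighbourhoods of a vector unfold to families of neighbourhoods of its
entries; an abstract filter in their place reduces continuity to the algebra of
limits. *)
Lemma continuous_rV n (f : 'rV[R]_n -> R) :
  (forall z (T : Type) (F : set_system T) (FF : Filter F) (g : T -> 'rV[R]_n),
    g @ F --> z -> f (g t) @[t --> F] --> f z) -> continuous f.
Proof. by move=> cf z; apply: (cf z _ (nbhs z) _ id); exact: cvg_id. Qed.

Lemma cvg_coord (T : Type) (F : set_system T) (FF : Filter F) n
    (f : T -> 'rV[R]_n) (a : 'rV[R]_n) i :
  f @ F --> a -> f t 0 i @[t --> F] --> a 0 i.
Proof.
by move=> fa; exact: (cvg_comp _ _ fa (@coord_continuous _ _ _ 0 i a)).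
Qed.

Lemma cvg_dot (T : Type) (F : set_system T) (FF : Filter F) n
    (f g : T -> 'rV[R]_n) (a b : 'rV[R]_n) :
  (forall i, f t 0 i @[t --> F] --> a 0 i) ->
  (forall i, g t 0 i @[t --> F] --> b 0 i) ->
  dot (f t) (g t) @[t --> F] --> dot a b.
Proof.
move=> fa gb; apply: cvg_big => [|i _]; first exact: add_continuous.
exact: cvgM.
Qed.

Lemma measurable_ball_rV n (a : 'rV[R]_n) (e : R) :
  measurable (ball a e : set 'rV[R]_n).
Proof.
have [e0|e0] := ltP 0 e; last first.
  rewrite (_ : ball a e = set0); first exact: measurable0.
  by apply/seteqP; split=> // x []; rewrite ltNge e0.
rewrite (_ : ball a e = \bigcap_(i in [set: 'I_n])
   ((fun v : 'rV[R]_n => v 0 i) @^-1` ball (a 0 i) e)).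
  apply: fin_bigcap_measurable => // i _; rewrite -[X in measurable X]setTI.
  apply: measurable_coord => //; apply: open_measurable; exact: ball_open.
apply/seteqP; split=> [x [_ xe] i _|x xe]; first exact: xe.
by split => // i j; rewrite (ord1 i); exact: xe.
Qed.

(** An open set is the union of the boxes with rational centre and radius of
the form 1 / (k + 1) that it contains, and there are countably many of them. *)
Lemma open_measurable_rV n (A : set 'rV[R]_n) : open A -> measurable A.
Proof.
move=> oA.
pose c (p : 'rV[rat]_n * nat) : 'rV[R]_n := map_mx (@ratr R) p.1.
pose I := [set p : 'rV[rat]_n * nat | ball (c p) (p.2.+1%:R^-1 : R) `<=` A].
have -> : A = \bigcup_(p in I) ball (c p) (p.2.+1%:R^-1 : R).
  apply/seteqP; split; last by move=> x [p Ip]; exact: Ip.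
  move=> x Ax; have /nbhs_ballP[e /= e0 xeA] := open_nbhs_nbhs (conj oA Ax).
  (* Radius below e / 2: a box around a point near x stays in the e-box. *)
  have [k ke] : exists k : nat, k.+1%:R^-1 < e / 2.
    exists (Num.truncn (e / 2)^-1); rewrite invf_plt ?posrE ?divr_gt0//.
    by rewrite truncnS_gt.
  pose d : R := k.+1%:R^-1.
  have d0 : 0 < d by rewrite invr_gt0.
  have /choice[q qP] : forall i, exists q : rat, `|x 0 i - ratr q| < d.
    move=> i.
    have [q] := @rat_in_itvoo R (x 0 i - d) (x 0 i + d) ltac:(lra).
    rewrite in_itv/= => /andP[q1 q2]; exists q; rewrite ltr_norml.
    by apply/andP; split; lra.
  exists (\row_i q i, k).
    move=> y [_ yc]; apply: xeA; split => // i j; rewrite (ord1 i).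
    have := yc 0 j; rewrite /= /ball/= !mxE => h1; have h2 := qP j.
    apply: (le_lt_trans (ler_distD (ratr (q j)) _ _)).
    by rewrite -/d in h1 ke; lra.
  split => //= i j; rewrite (ord1 i) /= /ball/= !mxE distrC; exact: qP.
rewrite bigcup_mkcond; apply: countable_bigcupT_measurable => [|p].
  exact: countableP.
by case: ifP => _; [exact: measurable_ball_rV|exact: measurable0].
Qed.

(** Stated for upper semicontinuous functions because of the dual function, an
infimum of continuous functions. *)
Lemma usc_measurable_rV n (f : 'rV[R]_n -> R) :
  (forall a, open [set x | f x < a]) ->
  measurable_fun setT (f : 'rV[R]_n -> measurableTypeR R).
Proof.
move=> oA; apply: (measurability _ (RGenInftyO.measurableE R)).
move=> _ [_ [a ->] <-]; rewrite setTI; apply: open_measurable_rV.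
rewrite (_ : _ @^-1` _ = [set x | f x < a]); first exact: oA.
by apply/seteqP; split=> x /=; rewrite in_itv.
Qed.

Lemma continuous_measurable_rV n (f : 'rV[R]_n -> R) :
  continuous f -> measurable_fun setT (f : 'rV[R]_n -> measurableTypeR R).
Proof.
move=> cf; apply: usc_measurable_rV => a.
rewrite (_ : [set x | _] = f @^-1` `]-oo, a[%classic).
  by move/continuousP : cf; apply; exact: interval_open.
by apply/seteqP; split=> x /=; rewrite in_itv.
Qed.

Lemma ord_recl_ind n (P : 'I_n.+1 -> Prop) :
  P 0 -> (forall j, P (lift 0 j)) -> forall i, P i.
Proof. by move=> P0 PS i; case: (unliftP 0 i) => [j ->|->]. Qed.

Lemma cvg_rV_cons (T : Type) (F : set_system T) (FF : Filter F) n
    (f : T -> R) (g : T -> 'rV[R]_n) (a : R) (b : 'rV[R]_n) :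
  f @ F --> a -> g @ F --> b ->
  (fun t => rV_cons (f t, g t)) @ F --> rV_cons (a, b).
Proof.
move=> fa gb; apply: cvg_rV; apply: ord_recl_ind => [|j].
  by under eq_fun do rewrite rV_cons0; rewrite rV_cons0.
under eq_fun do rewrite rV_consS; rewrite rV_consS.
exact: cvg_coord gb.
Qed.

Lemma rV_unconsK n : cancel (@rV_uncons R n) (@rV_cons R n).
Proof.
move=> v; apply/rowP; apply: ord_recl_ind => [|j]; first by rewrite rV_cons0.
by rewrite rV_consS /= mxE; congr (v _ _); exact/val_inj.
Qed.

Lemma continuous_rV_tail n :
  continuous (fun v : 'rV[R]_n.+1 => (rV_uncons v).2).
Proof.
move=> v; apply: (@cvg_rV _ (nbhs v) _) => i /=.
under eq_fun do rewrite mxE; rewrite mxE; exact: coord_continuous.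
Qed.

Lemma measurable_rV_consl n (v : 'rV[R]_n) :
  measurable_fun setT (fun x : measurableTypeR R => rV_cons (x, v)).
Proof.
apply: measurable_fun_rV; apply: ord_recl_ind => [|j].
  by under eq_fun do rewrite rV_cons0; exact: measurable_id.
by under eq_fun do rewrite rV_consS; exact: measurable_cst.
Qed.

Lemma measurable_rV_consr n (x : R) :
  measurable_fun setT (fun v : 'rV[R]_n => rV_cons (x, v)).
Proof.
apply: measurable_fun_rV; apply: ord_recl_ind => [|j].
  by under eq_fun do rewrite rV_cons0; exact: measurable_cst.
by under eq_fun do rewrite rV_consS; exact: measurable_coord.
Qed.

End rV_topology.

(** * Tonelli's theorem and substitution on the line *)

Section rV_integral.
Context {R : realType}.
Local Open Scope ereal_scope.

Lemma ge0_integral_rV_cons n (f : 'rV[R]_n.+1 -> \bar R) :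
  measurable_fun setT f -> (forall x, 0 <= f x) ->
  \int[lebesgue_rV n.+1]_z f z =
  \int[lebesgue_measure]_x \int[lebesgue_rV n]_v f (rV_cons (x, v)).
Proof.
move=> mf f0.
rewrite [LHS](@ge0_integral_pushforward _ _ _ _ R _ (@measurable_rV_cons R n)
  (lebesgue_measure \x lebesgue_rV n)%E setT f)//.
rewrite preimage_setT fubini_tonelli1//.
  exact: (measurableT_comp mf (@measurable_rV_cons R n)).
by move=> x; exact: f0.
Qed.

Lemma ge0_integral_rV_consC n (f : 'rV[R]_n.+1 -> \bar R) :
  measurable_fun setT f -> (forall x, 0 <= f x) ->
  \int[lebesgue_rV n.+1]_z f z =
  \int[lebesgue_rV n]_v \int[lebesgue_measure]_x f (rV_cons (x, v)).
Proof.
move=> mf f0.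
rewrite [LHS](@ge0_integral_pushforward _ _ _ _ R _ (@measurable_rV_cons R n)
  (lebesgue_measure \x lebesgue_rV n)%E setT f)//.
rewrite preimage_setT fubini_tonelli2//.
  exact: (measurableT_comp mf (@measurable_rV_cons R n)).
by move=> x; exact: f0.
Qed.

End rV_integral.

Section density.
Local Open Scope ereal_scope.
Context d (T : measurableType d) (R : realType).
Variable mu : {measure set T -> \bar R}.
Variable w : T -> R.
Hypotheses (mw : measurable_fun setT w) (w0 : forall x, (0 <= w x)%R).

Import HBNNSimple.

Lemma density_measure_exists : exists nu : {measure set T -> \bar R},
  forall A, measurable A -> nu A = \int[mu]_(x in A) (w x)%:E.
Proof.
pose m (A : set T) := \int[mu]_(x in A) (w x)%:E.
have m0 : m set0 = 0 by rewrite /m integral_set0.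
have m_ge0 A : 0 <= m A by apply: integral_ge0 => x _; rewrite lee_fin.
have m_sigma : semi_sigma_additive m.
  move=> F mF tF mUF; rewrite /m ge0_integral_bigcup//.
  - apply: is_cvg_nneseries => n _ _; exact: m_ge0.
  - by apply/measurable_EFinP; exact: measurable_funTS.
  - by move=> x _; rewrite lee_fin.
pose mix := isMeasure.Build _ _ _ m m0 m_ge0 m_sigma.
pose nu : {measure set T -> \bar R} := HB.pack m mix.
by exists nu.
Qed.

(** True for indicators by the hypothesis on nu; both sides are additive and
pass to monotone limits of simple functions. *)
Lemma ge0_integral_density (nu : {measure set T -> \bar R}) (f : T -> \bar R) :
  (forall A, measurable A -> nu A = \int[mu]_(x in A) (w x)%:E) ->
  measurable_fun setT f -> (forall x, 0 <= f x) ->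
  \int[nu]_x f x = \int[mu]_x (f x * (w x)%:E).
Proof.
move=> nuE mf f0; pose h := nnsfun_approx measurableT mf.
have mEw : measurable_fun setT (EFin \o w) by exact/measurable_EFinP.
have -> : \int[nu]_x f x = lim (\int[nu]_x (EFin \o h n) x @[n --> \oo]).
  have fE x : f x = lim ((EFin \o h n) x @[n --> \oo]).
    by apply/esym/cvg_lim => //; exact: cvg_nnsfun_approx.
  under eq_integral do rewrite fE.
  apply: monotone_convergence => //.
  - by move=> n; exact/measurable_EFinP.
  - by move=> n x _ //=; rewrite lee_fin.
  - by move=> x _ a b ab; rewrite lee_fin; exact/lefP/nd_nnsfun_approx.
have -> : \int[mu]_x (f x * (w x)%:E) =
    lim (\int[mu]_x ((EFin \o h n) x * (w x)%:E) @[n --> \oo]).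
  have fg x : f x * (w x)%:E = lim ((EFin \o h n) x * (w x)%:E @[n --> \oo]).
    by apply/esym/cvg_lim => //; apply: cvgeZr => //; exact: cvg_nnsfun_approx.
  under eq_integral do rewrite fg.
  apply: monotone_convergence => //.
  - by move=> n; apply: emeasurable_funM => //; exact/measurable_EFinP.
  - by move=> n x _ /=; rewrite mule_ge0 ?lee_fin.
  - move=> x _ a b ab/=; rewrite lee_wpmul2r ?lee_fin//.
    exact/lefP/nd_nnsfun_approx.
suff suf n : \int[mu]_x ((EFin \o h n) x * (w x)%:E) = \int[nu]_x (EFin \o h n)
  x.
  by under [in RHS]eq_fun do rewrite suf.
transitivity (\int[nu]_x
   (\sum_(y \in range (h n)) (y * \1_(h n @^-1` [set y]) x)%:E)); last first.
  by apply: eq_integral => t _; rewrite /= fimfunE -fsumEFin.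
have indich m r : measurable_fun setT (fun x => (r * \1_(h m @^-1` [set r])
  x)%:E).
  by apply: (measurable_comp measurableT) => //; exact: measurable_funM.
rewrite ge0_integral_fsum//; last by move=> m y _; exact: nnfun_muleindic_ge0.
transitivity (\int[mu]_x (\sum_(y \in range (h n))
    (y * \1_(h n @^-1` [set y]) x)%:E * (w x)%:E)).
  under [RHS]eq_integral => x xE.
    rewrite -ge0_mule_fsuml => [|y]; last exact: nnfun_muleindic_ge0.
    rewrite fsumEFin // -(fimfunE _ x); over.
  by [].
rewrite ge0_integral_fsum//; last 2 first.
  - by move=> y; exact: emeasurable_funM.
  - by move=> m y _; apply: mule_ge0;
      [exact: nnfun_muleindic_ge0|rewrite lee_fin].
apply: eq_fsbigr => r rhn.
under [RHS]eq_integral do rewrite EFinM.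
rewrite integralZl_indic_nnsfun => //.
have r0 : (0 <= r)%R by move: rhn; rewrite inE => -[x _ <-]; exact: fun_ge0.
under eq_integral do rewrite EFinM -muleA.
rewrite ge0_integralZl//.
- under eq_integral do rewrite muleC.
  rewrite (eq_integral ((EFin \o w) \_ (h n @^-1` [set r]))); last first.
    by move=> x xE; rewrite epatch_indic.
  rewrite -integral_mkcondr -nuE ?integral_indic ?setTI// ?setIT//.
- by apply: emeasurable_funM => //; exact/measurable_EFinP.
- by move=> x _; rewrite mule_ge0 ?lee_fin.
Qed.

End density.

Section change_of_variables_1d.
Context {R : realType}.
Local Notation lambda := (@lebesgue_measure R).

(** The image under F of the measure with density dF gives mass b - a to ]a, b]
by the fundamental theorem of calculus, hence is Lebesgue measure. This covers
every measurable G, which the induction on the dimension requires. *)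
Lemma ge0_integral_increasing_substitution (F dF u : R -> R) (G : R -> \bar R) :
  (forall x : R, is_derive x 1 F (dF x)) ->
  continuous dF -> (forall x, 0 <= dF x) ->
  {mono F : x y / x < y} -> cancel u F ->
  measurable_fun setT G -> (forall x, 0 <= G x)%E ->
  (\int[lambda]_x (G (F x) * (dF x)%:E) = \int[lambda]_x G x)%E.
Proof.
move=> dFP cdF dF0 Fmono uK mG G0.
have cF : continuous F by exact: is_derive_continuous dFP.
have mdF : measurable_fun setT (dF : measurableTypeR R -> measurableTypeR R).
  exact: continuous_measurable_fun.
have mF : measurable_fun setT (F : measurableTypeR R -> measurableTypeR R).
  exact: continuous_measurable_fun.
have [m1 m1E] := density_measure_exists lambda mdF dF0.
have m1oc a b : a <= b -> m1 `]u a, u b]%classic = (b - a)%:E.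
  rewrite le_eqVlt => /orP[/eqP->|ab].
    by rewrite set_itvoc0 measure0 subrr.
  have uab : u a < u b by rewrite -Fmono !uK.
  rewrite m1E; last exact: measurable_itv.
  rewrite integral_itv_obnd_cbnd; last first.
    by apply/measurable_EFinP; exact: measurable_funTS.
  rewrite (@continuous_FTC2 _ dF F)//.
  - by rewrite !uK EFinB.
  - exact: continuous_subspaceT.
  - split.
    + by move=> x _; exact: ex_derive.
    + exact/cvg_at_right_filter/cF.
    + exact/cvg_at_left_filter/cF.
  - by move=> x _; rewrite derive1E derive_val.
have lamE A : measurable A -> lambda A = pushforward m1 (F : measurableTypeR R
  -> measurableTypeR R) A.
  apply: (lebesgue_measure_unique (mu := pushforward m1 _)) => _ [[a b] _ <-].
  rewrite /= /pushforward.
  have -> : F @^-1` `]a, b] = `]u a, u b]%classic.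
    apply/seteqP; split=> x /=; rewrite !in_itv/= ![_ <= _]leNgt.
      by rewrite -[u a < x]Fmono -[u b < x]Fmono !uK.
    by rewrite -[u a < x]Fmono -[u b < x]Fmono !uK.
  transitivity (if a < b then (b - a)%:E else 0%E).
    by have := lebesgue_measure_itv `]a, b]; rewrite /= lte_fin -EFinB.
  case: ltP => [ab|ba]; first by rewrite m1oc// ltW.
  by rewrite set_itv_ge ?measure0// bnd_simp -Fmono !uK ltNge ba.
transitivity (\int[m1]_x G (F x))%E.
  rewrite (ge0_integral_density mdF dF0 m1E)//.
  exact: measurableT_comp.
rewrite -(@ge0_integral_pushforward _ _ _ _ _ _ mF m1 setT G)//.
by apply: eq_measure_integral => A mA _; exact/esym/lamE.
Qed.

End change_of_variables_1d.

(** * Schur complements and directional derivatives *)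

(** The unipotent block matrix L clears the first column below the pivot. *)
Lemma det_schur (F : fieldType) n (A : 'M[F]_n.+1) : A 0 0 != 0 ->
  \det A = A 0 0 * \det (\matrix_(i < n, j < n)
    (A (lift 0 i) (lift 0 j) - A (lift 0 i) 0 * A 0 (lift 0 j) / A 0 0)).
Proof.
move=> A00; set S := (X in _ = _ * \det X).
pose B : 'M[F]_(1 + n) := A.
have e00 : ulsubmx B = (A 0 0)%:M.
  apply/matrixP => i j; rewrite !mxE !ord1 eqxx mulr1n.
  by congr (A _ _); exact/val_inj.
have l0 : lshift n (0 : 'I_1) = 0 :> 'I_(1 + n) by exact/val_inj.
have rS (k : 'I_n) : rshift 1 k = lift 0 k :> 'I_(1 + n) by exact/val_inj.
pose L : 'M[F]_(1 + n) := block_mx 1%:M 0 (- (A 0 0)^-1 *: dlsubmx B) 1%:M.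
have LB : L *m B = block_mx (ulsubmx B) (ursubmx B) 0 S.
  rewrite -[in LHS](submxK B) mulmx_block !mul1mx !mul0mx !addr0;
    congr block_mx.
    rewrite e00 mul_mx_scalar scalerA mulrN mulfV// scaleN1r.
    by rewrite addNr.
  apply/matrixP => i j; rewrite !mxE big_ord1 !mxE !l0 !rS /=.
  by rewrite addrC /B; field.
have detL : \det L = 1 by rewrite det_lblock !det1 mulr1.
have := congr1 determinant LB; rewrite det_mulmx detL mul1r det_ublock e00.
by rewrite det_scalar expr1.
Qed.

Section lines.
Context {R : realType} {V : normedModType R}.
Implicit Types (f df : V -> R) (z e v : V).

Lemma is_derive_line f (z v : V) (t a : R) :
  is_derive (z + t *: v) v f a ->
  is_derive t (1 : R) (fun s => f (z + s *: v)) a.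
Proof.
move=> [df dfE].
have E : (fun h : R => h^-1 *: ((f \o shift (z + t *: v)) (h *: v)
  - f (z + t *: v)))
  = (fun h : R => h^-1 *: (((fun s => f (z + s *: v)) \o shift t)
    (h *: (1 : R)) - f (z + t *: v))).
  apply/funext => h /=; congr (_ *: (f _ - _)).
  have -> : h *: (1 : R) = h by rewrite /GRing.scale/= mulr1.
  by rewrite scalerDl addrCA.
by split; [rewrite /derivable -E|rewrite /derive -E -dfE].
Qed.

Lemma line_MVT f df (z v : V) (t : R) :
  (forall x, is_derive x v f (df x)) ->
  exists2 th : R, 0 <= th <= 1 &
    f (z + t *: v) - f z = df (z + (th * t) *: v) * t.
Proof.
move=> fP; pose g (s : R) := f (z + s *: v).
have gP (s : R) : is_derive s 1 g (df (z + s *: v)) by exact: is_derive_line.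
have cg : continuous g.
  exact: is_derive_continuous gP.
have g0 : g 0 = f z by rewrite /g scale0r addr0.
have [t0|t0] := leP 0 t.
  have [s] := @MVT_segment _ g _ 0 t t0 (fun x _ => gP x)
    (continuous_subspaceT cg).
  rewrite in_itv/= subr0 g0 => /andP[s0 st] ->.
  move: t0; rewrite le_eqVlt => /orP[/eqP t0|t0].
    by exists 0; rewrite ?lexx ?ler01// -t0 !mulr0.
  exists (s / t); first by rewrite divr_ge0 ?(ltW t0)//= ler_pdivrMr// mul1r.
  by rewrite divfK ?gt_eqF.
have [s] := @MVT_segment _ g _ t 0 (ltW t0) (fun x _ => gP x)
  (continuous_subspaceT cg).
rewrite in_itv/= sub0r g0 => /andP[ts s0] E.
exists (s / t).
  by rewrite -mulrNN -invrN divr_ge0 ?oppr_ge0 ?(ltW t0)//= ler_pdivrMr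
    ?oppr_gt0// mul1r lerN2.
by rewrite divfK ?lt_eqF// -[f _](opprK) -opprB/= -/(g t) opprK E mulrN opprK.
Qed.

(** The mean value theorem along e and then along e' gives p and q as values of
the two directional derivatives at points that tend to z. This is the chain
rule for the curve z + h e' + k(h) e when k is only known to tend to 0, which
is the situation of implicit differentiation. *)
Lemma two_direction_increment f df df' (z e e' : V) (k : R -> R) :
  (forall x, is_derive x e f (df x)) -> (forall x, is_derive x e' f (df' x)) ->
  {for z, continuous df} -> {for z, continuous df'} ->
  k h @[h --> (0 : R)^'] --> (0 : R) ->
  exists p q : R -> R,
    [/\ p h @[h --> (0 : R)^'] --> df z, q h @[h --> (0 : R)^'] --> df' z &
    forall h, f (z + h *: e' + k h *: e) - f z = p h * k h + q h * h].
Proof.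
move=> fe fe' cdf cdf' k0.
have /choice[th thP] : forall h, exists t : R, 0 <= t <= 1 /\
    f (z + h *: e' + k h *: e) - f (z + h *: e') = df (z + h *: e' + (t * k h)
      *: e) * k h.
  by move=> h; have [t t1 tE] := line_MVT (z + h *: e') (k h) fe; exists t.
have /choice[th' thP'] : forall h, exists t : R, 0 <= t <= 1 /\
    f (z + h *: e') - f z = df' (z + (t * h) *: e') * h.
  by move=> h; have [t t1 tE] := line_MVT z h fe'; exists t.
have h0 : (h : R) @[h --> (0 : R)^'] --> (0 : R) by exact: cvg_within.
have squeeze (t l : R -> R) : (forall h, 0 <= t h <= 1) ->
    l h @[h --> (0 : R)^'] --> (0 : R) -> t h * l h @[h --> (0 : R)^'] -->
      (0 : R).
  move=> t1 l0; apply/norm_cvg0P.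
  apply: (@squeeze_cvgr _ _ _ _ (fun=> 0) (fun h => `|l h|)).
  - apply: nearW => h; rewrite normr_ge0/= normrM -[leRHS]mul1r.
    by apply: ler_wpM2r => //; have /andP[t0 t1h] := t1 h; rewrite ger0_norm.
  - exact: cvg_cst.
  - exact/norm_cvg0P.
exists (fun h => df (z + h *: e' + (th h * k h) *: e)), (fun h =>
  df' (z + (th' h * h) *: e')).
split.
- have H : (fun h : R => z + h *: e' + (th h * k h) *: e) @ (0 : R)^' -->
      z + 0 *: e' + 0 *: e.
    apply: cvgD; first by apply: cvgD; [exact: cvg_cst|exact: cvgZr_tmp].
    by apply: cvgZr_tmp; apply: squeeze => // h; have [] := thP h.
  rewrite !scale0r !addr0 in H; exact: (cvg_comp _ df H).
- have H : (fun h : R => z + (th' h * h) *: e') @ (0 : R)^' --> z + 0 *: e'.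
    apply: cvgD; first exact: cvg_cst.
    by apply: cvgZr_tmp; apply: squeeze => // h; have [] := thP' h.
  rewrite scale0r addr0 in H; exact: (cvg_comp _ df' H).
- by move=> h; rewrite -(proj2 (thP h)) -(proj2 (thP' h)) addrA subrK.
Qed.

End lines.

Section derive_limits.
Context {R : realType} {V : normedModType R}.

Lemma is_deriveP (f : V -> R) (x v : V) (a : R) :
  is_derive x v f a <-> h^-1 * (f (x + h *: v) - f x) @[h --> (0 : R)^'] --> a.
Proof.
have E : (fun h : R => h^-1 *: ((f \o shift x) (h *: v) - f x)) =
         (fun h => h^-1 * (f (x + h *: v) - f x)).
  by apply/funext => h /=; rewrite [_ + x]addrC.
split=> [[df dfE]|fa].
  by rewrite -E -dfE; exact: df.
split; first by rewrite /derivable E; apply/cvg_ex; exists a.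
by rewrite /derive E; exact/cvg_lim.
Qed.

End derive_limits.

Section chain_rule.
Context {R : realType} {V : normedModType R}.

(** Composition on the line: f along k v is the restriction of f to the line z
+ R v composed with multiplication by k. *)
Lemma is_derive_dirZ (f : V -> R) (x v : V) (a k : R) :
  is_derive x v f a -> is_derive x (k *: v) f (k * a).
Proof.
move=> fa.
have g1 : is_derive (k * 0) (1 : R) (fun s => f (x + s *: v)) a.
  by apply: is_derive_line; rewrite mulr0 scale0r addr0.
have g2 : is_derive (0 : R) (1 : R) (fun s => k * s) k.
  by apply: is_derive_eq; rewrite /GRing.scale/= mulr1.
have := @is_derive1_comp _ _ _ _ _ _ g1 g2.
move=> /is_deriveP H; apply/is_deriveP.
rewrite mulrC; apply: cvg_trans H; apply: near_eq_cvg; near=> h.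
have -> : h *: (1 : R) = h by rewrite /GRing.scale/= mulr1.
by rewrite /= add0r mulr0 scale0r addr0 scalerA [h * k]mulrC.
Unshelve. all: by end_near. Qed.

Lemma is_derive_comp_dir (F : R -> R) (f : V -> R) (x v : V) (a b : R) :
  is_derive x v f a -> is_derive (f x) (1 : R) F b ->
  is_derive x v (fun y => F (f y)) (b * a).
Proof.
move=> fa Fb.
have g1 : is_derive (0 : R) (1 : R) (fun s => f (x + s *: v)) a.
  by apply: is_derive_line; rewrite scale0r addr0.
have g2 : is_derive (f (x + (0 : R) *: v)) (1 : R) F b by rewrite scale0r addr0.
have := @is_derive1_comp _ F (fun s => f (x + s *: v)) _ _ _ g2 g1.
move=> /is_deriveP H; apply/is_deriveP.
apply: cvg_trans H; apply: near_eq_cvg; near=> h.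
have -> : h *: (1 : R) = h by rewrite /GRing.scale/= mulr1.
by rewrite /= add0r scale0r addr0.
Unshelve. all: by end_near. Qed.

Lemma is_derive_mul (f k : V -> R) (x v : V) (a b : R) :
  is_derive x v f a -> is_derive x v k b ->
  is_derive x v (fun y => f y * k y) (f x * b + k x * a).
Proof. by move=> fa kb; exact: is_deriveM. Qed.

End chain_rule.

Section rV_cons_theory.
Context {R : realType} (n : nat).
Implicit Types (v w : 'rV[R]_n) (z : 'rV[R]_n.+1).

Lemma rV_tailE z i : (rV_uncons z).2 0 i = z 0 (lift 0 i).
Proof. by rewrite mxE; congr (z _ _); exact/val_inj. Qed.

Lemma rV_consD0 a v (h : R) :
  rV_cons (a, v) + h *: delta_mx 0 0 = rV_cons (a + h, v).
Proof.
apply/rowP; apply: ord_recl_ind => [|j].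
  by rewrite mxE !rV_cons0 !mxE !eqxx mulr1.
by rewrite mxE !rV_consS !mxE /= mulr0 addr0.
Qed.

Lemma rV_consDS a v (h : R) j :
  rV_cons (a, v) + h *: delta_mx 0 (lift 0 j) =
  rV_cons (a, v + h *: delta_mx 0 j).
Proof.
apply/rowP; apply: ord_recl_ind => [|i].
  by rewrite mxE !rV_cons0 !mxE /= mulr0 addr0.
by rewrite mxE !rV_consS !mxE (inj_eq lift_inj).
Qed.

Lemma dot_cons a b v w :
  dot (rV_cons (a, v)) (rV_cons (b, w)) = a * b + dot v w.
Proof.
rewrite /dot big_ord_recl !rV_cons0; congr (_ + _).
by apply: eq_bigr => i _; rewrite !rV_consS.
Qed.

Lemma rV_consB a b v w :
  rV_cons (a, v) - rV_cons (b, w) = rV_cons (a - b, v - w) :> 'rV[R]_n.+1.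
Proof.
apply/rowP; apply: ord_recl_ind => [|i]; rewrite mxE [X in _ + X]mxE.
  by rewrite !rV_cons0.
by rewrite !rV_consS !mxE.
Qed.

End rV_cons_theory.

(** * Strongly monotone maps and their fibre maps *)

Section strongly_monotone.
Context {R : realType}.

Definition strongly_monotone n (c : R) (T : 'rV[R]_n -> 'rV[R]_n) :=
  forall x y, c * dot (x - y) (x - y) <= dot (T x - T y) (x - y).

Definition C1_map n (T : 'rV[R]_n -> 'rV[R]_n) (J : 'rV[R]_n -> 'M[R]_n) :=
  [/\ forall i, continuous (fun x => T x 0 i),
      forall x i j,
        is_derive x (delta_mx 0 j : 'rV[R]_n) (fun y => T y 0 i) (J x i j)
    & forall i j, continuous (fun x => J x i j)].

(** Strong monotonicity between x + h e_i and x bounds the difference quotient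
of the i-th coordinate of T along e_i from below by c. *)
Lemma strongly_monotone_diag n c (T : 'rV[R]_n -> 'rV[R]_n) J x i :
  C1_map T J -> strongly_monotone c T -> c <= J x i i.
Proof.
move=> [_ dT _] mT; have /is_deriveP dTx := dT x i i.
apply: (@cvgr_to_ge _ _ _ _ _ _ _ dTx).
near=> h; have h0 : h != 0 by near: h; exact: nbhs_dnbhs_neq.
have := mT (x + h *: delta_mx 0 i) x.
rewrite addrAC subrr add0r !dotZr !dot_delta !mxE !eqxx mulr1 => H.
have h2 : 0 < h ^+ 2 by rewrite exprn_even_gt0.
rewrite -(ler_pM2r h2) expr2 (le_trans H)//.
rewrite le_eqVlt; apply/orP; left; apply/eqP; field.
by rewrite h0.
Unshelve. all: by end_near. Qed.

Lemma continuous_det (U : topologicalType) n (J : U -> 'M[R]_n) :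
  (forall i j, continuous (fun x => J x i j)) ->
  continuous (fun x => \det (J x)).
Proof.
move=> cJ; apply: continuous_big => [|s _ x]; first exact: add_continuous.
apply: cvgM; first exact: cvg_cst.
move: x; apply: continuous_big => [|i _]; first exact: mul_continuous.
exact: cJ.
Qed.

End strongly_monotone.

Section partial_inversion.
Context {R : realType} (n : nat) (c : R) (T : 'rV[R]_n.+1 -> 'rV[R]_n.+1)
  (J : 'rV[R]_n.+1 -> 'M[R]_n.+1).
Hypotheses (c0 : 0 < c) (CT : C1_map T J) (mT : strongly_monotone c T).

Let J00 x : 0 < J x 0 0.
Proof. by apply: (lt_le_trans c0); apply: strongly_monotone_diag CT mT. Qed.

Lemma first_coord_expand v a b :
  c * `|a - b| <= `|T (rV_cons (a, v)) 0 0 - T (rV_cons (b, v)) 0 0|.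
Proof.
have [->|ab] := eqVneq a b; first by rewrite !subrr normr0 mulr0.
have := mT (rV_cons (a, v)) (rV_cons (b, v)).
rewrite rV_consB subrr dot_cons.
have -> : dot (0 : 'rV[R]_n) 0 = 0 by rewrite /dot big1// => i _;
  rewrite !mxE mul0r.
rewrite -[X in dot X]rV_unconsK /rV_uncons dot_cons !mxE.
rewrite (_ : dot _ 0 = 0); last by rewrite /dot big1// => i _;
  rewrite [X in _ * X]mxE mulr0.
rewrite !addr0 => H; rewrite -(@ler_pM2r _ `|a - b|) ?normr_gt0 ?subr_eq0//.
rewrite -mulrA -normrM -expr2 ger0_norm ?sqr_ge0// expr2 (le_trans H)//.
by rewrite -normrM ler_norm.
Qed.

Lemma is_derive_first_coord v x :
  is_derive x (1 : R) (fun a => T (rV_cons (a, v)) 0 0)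
    (J (rV_cons (x, v)) 0 0).
Proof.
have [_ dT _] := CT.
have E (s : R) : rV_cons (0, v) + s *: delta_mx 0 0 = rV_cons (s, v).
  by rewrite rV_consD0 add0r.
have := @is_derive_line R 'rV[R]_n.+1 (fun y => T y 0 0) (rV_cons (0, v))
  (delta_mx 0 0) x (J (rV_cons (x, v)) 0 0).
rewrite E (_ : (fun s => _) = (fun a => T (rV_cons (a, v)) 0 0)); last first.
  by apply/funext => s; rewrite E.
by apply; exact: dT.
Qed.

Lemma first_coord_mono v :
  {mono (fun a => T (rV_cons (a, v)) 0 0) : x y / x < y}.
Proof.
apply: leW_mono; apply: le_mono => x y xy.
have cT := is_derive_continuous (is_derive_first_coord v).
have [z _ E] := MVT_segment (ltW xy) (fun x _ => is_derive_first_coord v x)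
  (continuous_subspaceT cT).
by rewrite -subr_gt0 E mulr_gt0 ?subr_gt0.
Qed.

(** By first_coord_expand the increasing function a |-> T_0 (a, v) moves by at
least |p - T_0 (0, v)| between 0 and M and between - M and 0, so it takes the
value p on [- M, M]. *)
Lemma first_coord_solve :
  exists u : R -> 'rV[R]_n -> R, forall p v, T (rV_cons (u p v, v)) 0 0 = p.
Proof.
suff /choice[u uP] : forall pv : R * 'rV[R]_n, exists x,
    T (rV_cons (x, pv.2)) 0 0 = pv.1 by exists (fun p v => u (p, v)) => p v;
      exact: uP.
move=> [p v] /=; pose F (a : R) : R := T (rV_cons (a, v)) 0 0; rewrite -/F.
have cF : continuous F.
  exact: is_derive_continuous (is_derive_first_coord v).
pose M := `|p - F 0| / c.
have M0 : 0 <= M by rewrite divr_ge0// ltW.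
have FM : F (- M) <= p <= F M.
  have monoF : {mono F : x y / x <= y}.
    by move=> x y; rewrite !leNgt first_coord_mono.
  have h1 := first_coord_expand v M 0; have h2 := first_coord_expand v 0 (- M).
  have cM : c * M = `|p - F 0| by rewrite /M mulrCA mulfV ?mulr1// gt_eqF.
  rewrite -!/(F _) subr0 (ger0_norm M0) cM in h1.
  rewrite -!/(F _) sub0r opprK (ger0_norm M0) cM in h2.
  rewrite [X in _ <= X]ger0_norm ?subr_ge0 ?monoF// in h1.
  rewrite [X in _ <= X]ger0_norm ?subr_ge0 ?monoF ?oppr_le0// in h2.
  have := ler_norm (p - F 0); have := ler_norm (- (p - F 0)); rewrite normrN.
  by move=> h3 h4; apply/andP; split; lra.
have [||x _ xE] := @IVT _ F (- M) M p _ (continuous_subspaceT cF).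
- by rewrite -subr_ge0 opprK addr_ge0.
- by have /andP[h1 h2] := FM; rewrite min_l ?max_r ?FM// (le_trans h1).
- by exists x.
Qed.

Variable u : R -> 'rV[R]_n -> R.
Hypothesis uP : forall p v, T (rV_cons (u p v, v)) 0 0 = p.

Let Z p v : 'rV[R]_n.+1 := rV_cons (u p v, v).

Definition partial_map p v : 'rV[R]_n := (rV_uncons (T (Z p v))).2.

Definition schur_mx z : 'M[R]_n := \matrix_(i, j)
  (J z (lift 0 i) (lift 0 j) - J z (lift 0 i) 0 * J z 0 (lift 0 j) / J z 0 0).

Lemma partial_mapE p v : T (Z p v) = rV_cons (p, partial_map p v).
Proof. by rewrite -[LHS]rV_unconsK /rV_uncons uP. Qed.

Lemma first_coord_solveK a v : u (T (rV_cons (a, v)) 0 0) v = a.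
Proof.
apply/eqP; rewrite -subr_eq0 -normr_eq0 eq_le normr_ge0 andbT.
rewrite -(pmulr_rle0 _ c0); apply: (le_trans (first_coord_expand v _ _)).
by rewrite uP subrr normr0.
Qed.

(** By first_coord_expand, c |u (q, w) - u (p, v)| <= |q - T_0 (u (p, v), w)|,
and the right-hand side vanishes at (q, w) = (p, v). *)
Lemma cvg_first_coord_solve (I : Type) (F : set_system I) (FF : Filter F)
    (f : I -> R) (g : I -> 'rV[R]_n) p v :
  f @ F --> p -> g @ F --> v -> (fun t => u (f t) (g t)) @ F --> u p v.
Proof.
move=> fp gv; apply/subr_cvg0/norm_cvg0P.
apply: (@squeeze_cvgr _ _ _ _ (fun=> 0)
  (fun t => c^-1 * `|f t - T (rV_cons (u p v, g t)) 0 0|)).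
- apply: nearW => t; rewrite normr_ge0/= mulrC ler_pdivlMr// mulrC.
  by rewrite (le_trans (first_coord_expand (g t) _ _))// uP.
- exact: cvg_cst.
- rewrite -[X in _ --> X](mulr0 c^-1); apply: cvgM; first exact: cvg_cst.
  rewrite -(normr0 R); apply: cvg_norm; rewrite -(subrr p); apply: cvgB => //.
  rewrite -[X in _ --> X](uP p v).
  have [cT _ _] := CT.
  apply: (cvg_comp (fun t => rV_cons (u p v, g t)) (fun z => T z 0 0)
    _ (cT 0 _)).
  by apply: cvg_rV_cons => //; exact: cvg_cst.
Qed.

Lemma cvg_slice (I : Type) (F : set_system I) (FF : Filter F)
    (f : I -> R) (g : I -> 'rV[R]_n) p v :
  f @ F --> p -> g @ F --> v -> (fun t => Z (f t) (g t)) @ F --> Z p v.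
Proof.
by move=> fp gv; apply: cvg_rV_cons => //; exact: cvg_first_coord_solve.
Qed.

Lemma continuous_schur i j : continuous (fun z => schur_mx z i j).
Proof.
have [_ _ cJ] := CT; apply: continuous_rV => z I F FF g gz.
have cg i' j' : J (g t) i' j' @[t --> F] --> J z i' j'.
  exact: (cvg_comp _ (fun z => J z i' j') gz (cJ _ _ z)).
under eq_fun do rewrite mxE; rewrite mxE.
apply: cvgB => //; apply: cvgM; first exact: cvgM.
by apply: cvgV => //; rewrite gt_eqF.
Qed.

(** Implicit differentiation. Along the j-th axis the first argument moves by
k(h), and the first coordinate of T does not change: p0 k + q0 h = 0, where p0
and q0 tend to the entries (0, 0) and (0, j + 1) of J. Substituting k = - q0 h
/ p0 in the increments of the other coordinates produces the Schur
complement. *)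
Lemma partial_map_C1 p : C1_map (partial_map p) (fun v => schur_mx (Z p v)).
Proof.
have [cT dT cJ] := CT; split.
- move=> i; apply: continuous_rV => v I F FF g gv; rewrite /partial_map.
  under eq_fun do rewrite rV_tailE; rewrite rV_tailE.
  apply: (cvg_comp _ (fun z => T z 0 (lift 0 i)) _ (cT _ _)).
  by apply: cvg_slice => //; exact: cvg_cst.
- move=> v i j; apply/is_deriveP.
  pose k h := u p (v + h *: delta_mx 0 j) - u p v.
  have k0 : k h @[h --> (0 : R)^'] --> (0 : R).
    apply/subr_cvg0; apply: cvg_first_coord_solve; first exact: cvg_cst.
    rewrite -[X in _ --> X]addr0; apply: cvgD; first exact: cvg_cst.
    by rewrite -(scale0r (delta_mx 0 j)); apply: cvgZr_tmp; exact: cvg_within.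
  have zE h : Z p (v + h *: delta_mx 0 j) =
      Z p v + h *: delta_mx 0 (lift 0 j) + k h *: delta_mx 0 0.
    by rewrite /Z rV_consDS rV_consD0 /k subrKC.
  have [p0 [q0 [cp0 cq0 E0]]] := two_direction_increment
    (fun x => dT x 0 0) (fun x => dT x 0 (lift 0 j)) (cJ _ _ (Z p v))
      (cJ _ _ (Z p v)) k0.
  have [p1 [q1 [cp1 cq1 E1]]] := two_direction_increment
    (fun x => dT x (lift 0 i) 0) (fun x => dT x (lift 0 i) (lift 0 j))
    (cJ _ _ (Z p v)) (cJ _ _ (Z p v)) k0.
  have H : (fun h => q1 h - p1 h * q0 h / p0 h) @ (0 : R)^' -->
    schur_mx (Z p v) i j.
    rewrite mxE; apply: cvgB => //; apply: cvgM; first exact: cvgM.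
    by apply: cvgV => //; rewrite gt_eqF.
  apply: cvg_trans H; apply: near_eq_cvg; near=> h.
  rewrite /partial_map !rV_tailE zE E1.
  have := E0 h; rewrite -zE !uP subrr => /eqP;
    rewrite eq_sym addr_eq0 => /eqP kE.
  have p0h : p0 h != 0 by near: h; apply: (cvgr_neq0 _ cp0); rewrite gt_eqF.
  have h0 : h != 0 by near: h; exact: nbhs_dnbhs_neq.
  have -> : k h = - (q0 h * h) / p0 h by rewrite -kE mulrAC mulfV ?mul1r.
  by field; rewrite p0h h0.
- move=> i j; apply: continuous_rV => v I F FF g gv.
  apply: (cvg_comp _ (fun z => schur_mx z i j) _ (@continuous_schur _ _ _)).
  by apply: cvg_slice => //; exact: cvg_cst.
Unshelve. all: by end_near. Qed.

(** The two points of the fibre have the same first image coordinate, so their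
first coordinates drop out of the scalar product and only enlarge the squared
distance. *)
Lemma partial_map_strongly_monotone p : strongly_monotone c (partial_map p).
Proof.
move=> v w; have := mT (Z p v) (Z p w).
rewrite !partial_mapE !rV_consB subrr !dot_cons mul0r add0r.
apply: le_trans; rewrite ler_pM2l// lerDr -expr2 sqr_ge0 //.
Qed.

Lemma det_schur_mx z : \det (J z) = J z 0 0 * \det (schur_mx z).
Proof. by apply: det_schur; rewrite gt_eqF. Qed.

End partial_inversion.

Section change_of_variables.
Context {R : realType}.

Lemma measurable_C1_map n (T : 'rV[R]_n -> 'rV[R]_n) J :
  C1_map T J -> measurable_fun setT T.
Proof.
move=> [cT _ _]; apply: measurable_fun_rV => i; exact: continuous_measurable_rV.
Qed.

(** In the inductive step both sides are compared with the integral of k, the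
integrand in the mixed coordinates (p, v) with p the first image coordinate:
for fixed v the substitution p = T_0 (a, v) leads from the left-hand side to k,
and for fixed p the induction hypothesis for partial_map leads from k to g. *)
Theorem ge0_change_of_variables n (c : R) (T : 'rV[R]_n -> 'rV[R]_n) J :
  0 < c -> C1_map T J -> strongly_monotone c T ->
  (forall x, 0 < \det (J x)) /\
  forall g : 'rV[R]_n -> \bar R,
    measurable_fun setT g -> (forall x, 0 <= g x)%E ->
    (\int[lebesgue_rV n]_x (g (T x) * (\det (J x))%:E) =
     \int[lebesgue_rV n]_x g x)%E.
Proof.
elim: n T J => [|n IH] T J c0 CT mT.
  split=> [x|g mg g0]; first by rewrite det_mx00.
  by apply: eq_integral => x _; rewrite det_mx00 mule1 (thinmx0 (T x))
    (thinmx0 x).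
have [u uP] := first_coord_solve c0 CT mT.
have IHp p := IH _ _ c0 (partial_map_C1 c0 CT mT uP p)
  (partial_map_strongly_monotone c0 mT uP p).
have J00 z : 0 < J z 0 0.
  by apply: (lt_le_trans c0); apply: strongly_monotone_diag CT mT.
have uK a v : u (T (rV_cons (a, v)) 0 0) v = a := first_coord_solveK c0 mT uP a
  v.
have zE z : exists p v, z = rV_cons (u p v, v).
  by exists (T z 0 0), (rV_uncons z).2; rewrite -{1 2}[z]rV_unconsK /rV_uncons
    uK.
have detE z := det_schur_mx c0 CT mT z.
split=> [z|g mg g0].
  have [p [v ->]] := zE z; rewrite detE mulr_gt0//.
  exact: (IHp p).1.
have mdet : measurable_fun setT (fun z => (\det (J z))%:E).
  apply/measurable_EFinP; apply: continuous_measurable_rV;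
    apply: continuous_det.
  by have [] := CT.
have det0 z : 0 <= \det (J z).
  have [p [v ->]] := zE z; rewrite detE mulr_ge0// ?ltW//; exact: (IHp p).1.
have dets0 z : 0 <= \det (schur_mx J z).
  have [p [v ->]] := zE z; rewrite ltW//; exact: (IHp p).1.
rewrite ge0_integral_rV_consC; last 2 first.
- by apply: emeasurable_funM => //; exact: (measurableT_comp mg
  (measurable_C1_map CT)).
- by move=> x; rewrite mule_ge0// lee_fin.
pose Z (z : 'rV[R]_n.+1) : 'rV[R]_n.+1 :=
  rV_cons (u (z 0 0) (rV_uncons z).2, (rV_uncons z).2).
pose k z := (g (T (Z z)) * (\det (schur_mx J (Z z)))%:E)%E.
(* Z inverts the first coordinate only: (p, v) |-> (u (p, v), v). *)
have mZ : measurable_fun setT Z.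
  apply: measurable_fun_rV => i; apply: continuous_measurable_rV.
  apply: continuous_rV => z I F FF h hz.
  apply: (cvg_comp (fun t => Z (h t)) (fun z : 'rV[R]_n.+1 => z 0 i)
    _ (@coord_continuous _ _ _ 0 i _)).
  apply: (cvg_slice c0 CT mT uP).
    exact: cvg_coord hz.
  exact: (cvg_comp _ _ hz (@continuous_rV_tail _ _ z)).
have mk : measurable_fun setT k.
  apply: emeasurable_funM.
    exact: (measurableT_comp mg (measurableT_comp (measurable_C1_map CT) mZ)).
  apply: (measurableT_comp (f := fun z => (\det (schur_mx J z))%:E) _ mZ).
  apply/measurable_EFinP; apply: continuous_measurable_rV;
    apply: continuous_det => i j.
  exact: (continuous_schur c0 CT mT).
have k0 z : (0 <= k z)%E by rewrite mule_ge0// lee_fin.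
have Zc p v : Z (rV_cons (p, v)) = rV_cons (u p v, v).
  by rewrite /Z rV_cons0 -[(rV_uncons _).2]/(rV_uncons
    (rV_cons (p, v))).2 rV_consK.
transitivity (\int[lebesgue_rV n.+1]_z k z)%E.
  rewrite [RHS](ge0_integral_rV_consC mk k0); apply: eq_integral => v _.
  have mkv :
      measurable_fun setT (fun p : measurableTypeR R => k (rV_cons (p, v))).
    exact: (measurableT_comp mk (measurable_rV_consl v)).
  have cJ0 : continuous (fun a => J (rV_cons (a, v)) 0 0).
    move=> a; have [_ _ cJ] := CT.
    apply: (cvg_comp (fun t => rV_cons (t, v)) (fun z => J z 0 0) _ (cJ _ _ _)).
    by apply: cvg_rV_cons; [exact: cvg_id|exact: cvg_cst].
  have H := ge0_integral_increasing_substitution (is_derive_first_coord CT v)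
    cJ0
    (fun a => ltW (J00 _)) (first_coord_mono c0 CT mT v) (fun p => uP p v).
  have {H} <- := H (fun p => k (rV_cons (p, v))) mkv (fun p => k0 _).
  apply: eq_integral => a _.
  by rewrite /k Zc uK detE EFinM -muleA [X in (_ * X)%E]muleC.
rewrite (ge0_integral_rV_cons mk k0) (ge0_integral_rV_cons mg g0).
apply: eq_integral => p _.
rewrite -((IHp p).2 (fun w => g (rV_cons (p, w)))).
- by apply: eq_integral => v _; rewrite /k Zc (partial_mapE uP).
- exact: (measurableT_comp mg (@measurable_rV_consr _ _ p)).
- by move=> w; exact: g0.
Qed.

End change_of_variables.

(** * Gradients of strictly convex functions *)

Section convexity.
Context {R : realType} (n : nat) (psi : 'rV[R]_n -> R).
Hypothesis scv : strictly_convex psi.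

Lemma strictly_convexW t x y : 0 <= t <= 1 ->
  psi (t *: x + (1 - t) *: y) <= t * psi x + (1 - t) * psi y.
Proof.
move=> /andP[]; rewrite le_eqVlt => /orP[/eqP <- _|t0].
  by rewrite scale0r add0r subr0 scale1r mul0r add0r mul1r.
rewrite le_eqVlt => /orP[/eqP -> |t1].
  by rewrite subrr scale0r addr0 scale1r mul0r addr0 mul1r.
have [->|xy] := eqVneq x y.
  by rewrite -scalerDl -mulrDl addrCA subrr addr0 scale1r mul1r.
by apply/ltW/scv => //; rewrite t0.
Qed.

Lemma convex_average m (y : 'I_m -> 'rV[R]_n) : (0 < m)%N ->
  psi (m%:R^-1 *: \sum_i y i) <= m%:R^-1 * \sum_i psi (y i).
Proof.
case: m y => // m y _; elim: m y => [|m IH] y.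
  by rewrite !big_ord1 invr1 scale1r mul1r.
rewrite big_ord_recl [in leRHS]big_ord_recl.
set S := \sum_(i < m.+1) _; set P := \sum_(i < m.+1) psi _.
pose t : R := m.+2%:R^-1.
have t01 : 0 <= t <= 1 by rewrite invr_ge0 ler0n invf_le1// ler1n.
have tE : (1 - t) * m.+1%:R^-1 = t.
  by rewrite /t -[m.+2%:R]natr1; field; rewrite !nat1r natr1 !pnatr_eq0.
have -> : m.+2%:R^-1 *: (y ord0 + S) = t *: y ord0 + (1 - t)
  *: (m.+1%:R^-1 *: S).
  by rewrite scalerA tE scalerDr.
apply: (le_trans (strictly_convexW _ _ t01)).
rewrite -/t mulrDr lerD2l -[in leRHS]tE -mulrA ler_wpM2l ?subr_ge0 ?(andP
  t01).2//.
exact: IH.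
Qed.

Variable g : 'rV[R]_n -> 'rV[R]_n.
Hypothesis dpsi : forall x i,
  is_derive x (delta_mx 0 i : 'rV[R]_n) psi (g x 0 i).

(** Only partial derivatives are available, so the comparison uses
axis-parallel displacements: x lies between x + v and x - h v, and x - h v is
the average of the n points x - n h v_i e_i. Dividing the two convexity
inequalities by h and letting h decrease to 0 gives <g x, v> <= psi (x + v) -
psi x. *)
Lemma tangent_le x y : psi x + dot (g x) (y - x) <= psi y.
Proof.
have [v {y}->] : exists v, y = x + v by exists (y - x); rewrite addrC subrK.
rewrite [x + v]addrC addrK.
have [n0|n0] := posnP n.
  have -> : v = 0 by apply/rowP => i; have := ltn_ord i; lia.
  by rewrite add0r /dot big1 ?addr0// => i _; rewrite mxE mulr0.
pose q (h : R) := n%:R^-1 * \sum_(i < n) - (h^-1 *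
  (psi (x + h *: ((- (n%:R * v 0 i)) *: delta_mx 0 i)) - psi x)).
have nz : (n%:R : R) != 0 by rewrite pnatr_eq0 -lt0n.
have qcvg : q h @[h --> (0 : R)^'] --> dot (g x) v.
  have -> : dot (g x) v = n%:R^-1 * \sum_(i < n) - (- (n%:R * v 0 i) * g x 0 i).
    rewrite mulr_sumr; apply: eq_bigr => i _; field.
    exact: nz.
  apply: cvgM; first exact: cvg_cst.
  apply: cvg_big => [|i _]; first exact: add_continuous.
  by apply: cvgN; apply/is_deriveP; exact: is_derive_dirZ.
rewrite -lerBrDl; apply: (@cvgr_to_le _ _ _ _ _ _ _ (cvg_dnbhs_at_right qcvg)).
near=> h; have h0 : 0 < h by near: h; exact: nbhs_right_gt.
have hp : 0 < 1 + h by rewrite addr_gt0.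
pose y i := x - (h * (n%:R * v 0 i)) *: delta_mx 0 i.
have E1 : n%:R^-1 *: \sum_i y i = x - h *: v.
  rewrite sumrB sumr_const card_ord -[x *+ n]scaler_nat scalerBr scalerA
    mulVf// scale1r.
  congr (_ - _); rewrite scaler_sumr [in RHS](row_sum_delta v) scaler_sumr.
  apply: eq_bigr => i _; rewrite !scalerA; congr (_ *: _); field.
  exact: nz.
have H1 := convex_average y n0; rewrite E1 in H1.
have t01 : 0 <= h / (1 + h) <= 1.
  by rewrite divr_ge0 ?(ltW h0) ?(ltW hp)//= ler_pdivrMr// mul1r lerDr.
have := strictly_convexW (v + x) (x - h *: v) t01.
have -> : 1 - h / (1 + h) = (1 + h)^-1 by field; rewrite gt_eqF.
have -> : (h / (1 + h)) *: (v + x) + (1 + h)^-1 *: (x - h *: v) = x.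
  by apply/rowP => i; rewrite !mxE; field; rewrite gt_eqF.
move=> H2.
have H3 : (1 + h) * psi x <= h * psi (v + x) + psi (x - h *: v).
  move: H2; rewrite -(ler_pM2l hp) mulrDr !mulrA [(1 + h)
    * h]mulrC mulfK ?gt_eqF//.
  by rewrite mulfV ?gt_eqF// mul1r.
have qE : q h = h^-1 * (psi x - n%:R^-1 * \sum_i psi (y i)).
  have E : psi x = n%:R^-1 * \sum_(i < n) psi x.
    by rewrite sumr_const card_ord -[psi x *+ n]mulr_natl mulrA mulVf// mul1r.
  rewrite [in RHS]E -mulrBr -sumrB [RHS]mulrCA; congr (_ * _).
  rewrite mulr_sumr; apply: eq_bigr => i _.
  by rewrite /y scalerA mulrN scaleNr -mulrN opprB.
rewrite qE mulrC ler_pdivrMr//; lra.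
Unshelve. all: by end_near. Qed.

Lemma grad_monotone x y : 0 <= dot (g x - g y) (x - y).
Proof.
have := tangent_le x y; have := tangent_le y x.
by rewrite dotBl -[y - x]opprB [dot _ (- _)]dotC dotNl [dot (x - y) _]dotC; lra.
Qed.

Hypothesis cpsi : continuous psi.

(** The function q, psi minus its tangent at 0, is positive away from 0 by
strict convexity, hence at least some a > 0 on the unit sphere, hence at least
a |x| for |x| >= 1; and q x <= <g x - g 0, x> by the tangent inequality at
x. *)
Lemma grad_coercive (K : R) : exists2 r : R, 0 < r &
  forall (x : 'rV[R]_n) i, r < `|x 0 i| -> K <= dot (g x - g 0) x.
Proof.
pose q x := psi x - psi 0 - dot (g 0) x.
have qD x : q x <= dot (g x - g 0) x.
  by have := tangent_le x 0; rewrite sub0r [dot _ (- _)]dotC dotNl dotBl dotC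
    /q; lra.
have q0 x : x != 0 -> 0 < q x.
  move=> x0; have := tangent_le 0 (2^-1 *: x); rewrite subr0 dotZr.
  have := @scv 2^-1 x 0; rewrite scaler0 addr0 => /(_ _ x0) h1.
  by have : 0 < (2^-1 : R) < 1 by [lra]; move=> /h1; rewrite /q; lra.
have qZ x s : 1 <= s -> s * q (s^-1 *: x) <= q x.
  move=> s1; have s0 : 0 < s by apply: lt_le_trans s1.
  have := @strictly_convexW s^-1 x 0; rewrite scaler0 addr0.
  rewrite invr_ge0 (ltW s0) invf_le1// s1 => /(_ isT) H.
  rewrite mulrC -ler_pdivlMr// /q dotZr [leRHS]mulrC !mulrBr; move: H.
  by rewrite mulrBl mul1r; lra.
pose S := [set x : 'rV[R]_n | `|x| = 1].
have [S0|S0] := pselect (S !=set0); last first.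
  exists 1 => // x i xi; exfalso; apply: S0; exists (`|x|^-1 *: x).
  have x0 : x != 0 by apply/eqP => x0; move: xi;
    rewrite x0 mxE normr0 ltNge ler01.
  by rewrite /S/= normrZ normfV normr_id mulVf// normr_eq0.
have cS : compact S.
  apply: bounded_closed_compact.
    by exists 1; split=> // M M1 x; rewrite /S/= => ->; exact: ltW.
  rewrite (_ : S = (fun x : 'rV[R]_n => `|x|) @^-1` [set 1])//.
  by apply: closed_comp; [move=> x _; exact: norm_continuous|exact: closed_eq].
have cq : continuous q.
  apply: continuous_rV => z I F FF h hz; rewrite /q /dot.
  apply: cvgB.
    by apply: cvgB; [exact: (cvg_comp _ _ hz (@cpsi z))|exact: cvg_cst].
  apply: cvg_big => [|i _]; first exact: add_continuous.
  apply: cvgM; first exact: cvg_cst.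
  exact: cvg_coord hz.
have [m mS mmin] := EVT_min_rV S0 cS (continuous_subspaceT cq).
have m1 : `|m| = 1 by move: mS; rewrite inE.
have a0 : 0 < q m by apply: q0; rewrite -normr_gt0 m1.
exists (Num.max 1 (K / q m)); first by rewrite lt_max ltr01.
move=> x i; rewrite gt_max => /andP[x1 xK].
have xi : `|x 0 i| <= `|x|.
  by rewrite [leRHS]/Num.norm /= mx_normrE; apply/bigmax_geP; right => /=;
    exists (0, i).
have nx1 : 1 <= `|x| by rewrite (le_trans (ltW x1)).
have nx0 : 0 < `|x| by apply: lt_le_trans nx1.
apply: (le_trans _ (qD x)); apply: (le_trans _ (qZ _ _ nx1)).
have qm : q m <= q (`|x|^-1 *: x).
  by apply: mmin; rewrite inE /S/= normrZ normfV normr_id mulVf// gt_eqF.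
have : K <= `|x| * q m by rewrite -ler_pdivrMr// (le_trans (ltW xK)).
by move=> /le_trans; apply; rewrite ler_pM2l.
Qed.

End convexity.

(** * The dual function *)

Section dual_function.
Context {R : realType} (n : nat).
Implicit Types (f : 'rV[R]_n -> R) (x y z : 'rV[R]_n).

Let S f y : set R :=
  [set expR (- dot y z) / expR (- f z) | z in [set: 'rV[R]_n]].

Let S_nonempty f y : S f y !=set0.
Proof. by exists (expR (- dot y 0) / expR (- f 0)); exists 0. Qed.

Let S_lbound f y : lbound (S f y) 0.
Proof. by move=> _ [z _ <-]; rewrite divr_ge0 ?expR_ge0. Qed.

Let SE f y z : expR (- dot y z) / expR (- f z) = expR (f z - dot y z).
Proof. by rewrite -expRN opprK -expRD addrC. Qed.

Lemma dual_ge0 f y : 0 <= dual (fun x => expR (- f x)) y.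
Proof. exact: lb_le_inf (S_nonempty f y) (@S_lbound f y). Qed.

Lemma dual_le f y z : dual (fun x => expR (- f x)) y <= expR (f z - dot y z).
Proof.
apply: ge_inf; first by exists 0; exact: S_lbound.
by exists z => //; rewrite SE.
Qed.

Lemma dual_ltP f y a :
  dual (fun x => expR (- f x)) y < a <-> exists z, expR (f z - dot y z) < a.
Proof.
split=> [/(inf_lt (S_nonempty f y))[_ [z _ <-]]|[z za]].
  by rewrite SE => za; exists z.
exact: le_lt_trans (dual_le f y z) za.
Qed.

Lemma measurable_dual f : measurable_fun setT (dual (fun x => expR (- f x))).
Proof.
apply: usc_measurable_rV => a.
rewrite (_ : [set x | _] = \bigcup_z [set y | expR (f z - dot y z) < a]).
  apply: bigcup_open => z _.
  rewrite (_ : [set y | _] = (fun y => expR (f z - dot y z))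
    @^-1` [set t | t < a])//.
  apply: open_comp; last exact: open_lt.
  move=> y _; move: y; apply: continuous_rV => y I F FF h hy; rewrite /dot.
  apply: cvg_expR.
  apply: cvgB; first exact: cvg_cst.
  apply: cvg_big => [|i _]; first exact: add_continuous.
  apply: cvgM; last exact: cvg_cst.
  exact: cvg_coord hy.
apply/seteqP; split=> y /=.
  by move=> /dual_ltP[z za]; exists z.
by move=> [z _ za]; apply/dual_ltP; exists z.
Qed.

(** The infimum defining the dual function at a subgradient s of f at x is
attained at x. *)
Lemma dual_subgradient f x s : (forall z, f x + dot s (z - x) <= f z) ->
  dual (fun x => expR (- f x)) s = expR (f x - dot s x).
Proof.
move=> fs; apply/eqP; rewrite eq_le dual_le/=.
apply: lb_le_inf (S_nonempty f s) _ => _ [z _ <-]; rewrite SE ler_expR.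
by have := fs z; rewrite dotBr; lra.
Qed.

Lemma dual_mono f1 f2 y : (forall z, f1 z <= f2 z) ->
  dual (fun x => expR (- f1 x)) y <= dual (fun x => expR (- f2 x)) y.
Proof.
move=> f12; apply: lb_le_inf (S_nonempty f2 y) _ => _ [z _ <-].
by apply: (le_trans (dual_le f1 y z)); rewrite SE ler_expR lerD2r.
Qed.

(** The infimum is tested at the vertex of [-1, 1]^n that has the signs of
y. *)
Lemma dual_bound f : exists2 C : R, 0 <= C &
  forall y, dual (fun x => expR (- f x)) y <= C * expR (- \sum_i `|y 0 i|).
Proof.
pose v (b : {ffun 'I_n -> bool}) : 'rV[R]_n := \row_i (if b i then 1 else -1).
exists (\sum_b expR (f (v b))) => [|y].
  by apply: sumr_ge0 => b _; exact: expR_ge0.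
pose b : {ffun 'I_n -> bool} := [ffun i => 0 <= y 0 i].
apply: (le_trans (dual_le f y (v b))).
have -> : dot y (v b) = \sum_i `|y 0 i|.
  apply: eq_bigr => i _; rewrite !mxE ffunE; case: leP => y0.
    by rewrite mulr1 ger0_norm.
  by rewrite mulrN1 ltr0_norm.
rewrite expRD ler_wpM2r ?expR_ge0// (bigD1 b)//= lerDl.
by apply: sumr_ge0 => ? _; exact: expR_ge0.
Qed.

End dual_function.

Section exponential_integrable.
Context {R : realType}.
Local Notation lambda := (@lebesgue_measure R).

(** Comparison with 2 / (1 + x^2). *)
Lemma integral_expR_Nabs_lty : (\int[lambda]_x (expR (- `|x|))%:E < +oo)%E.
Proof.
have c2 : continuous (fun x : R => 2 * (oneDsqr x)^-1 : R).
  by move=> x; apply: cvgM; [exact: cvg_cst|exact: continuous_oneDsqrV].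
have cN : continuous (fun x : R => expR (- `|x|)).
  move=> x; apply: cvg_expR.
  by apply: cvgN; exact: norm_continuous.
have i0 : (\int[lambda]_x (2 * (oneDsqr x)^-1)%:E < +oo)%E.
  have f0 (x : R) : 0 <= 2 * (oneDsqr x)^-1.
    by rewrite mulr_ge0// invr_ge0 (le_trans ler01).
  rewrite (ge0_symfun_integralT f0 c2); last first.
    by move=> x; rewrite /= /oneDsqr sqrrN.
  rewrite -set_itvcy; under eq_integral do rewrite EFinM.
  rewrite ge0_integralZl//; last first.
  - apply/measurable_EFinP; apply: measurable_funTS;
    apply: continuous_measurable_fun.
    exact: continuous_oneDsqrV.
  by rewrite integral0y_oneDsqr -!EFinM ltry.
apply: le_lt_trans i0; apply: ge0_le_integral => //.
- by apply/measurable_EFinP; exact: continuous_measurable_fun.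
- by apply/measurable_EFinP; exact: continuous_measurable_fun.
move=> x _; rewrite lee_fin expRN -[leRHS]invrK invfM invrK.
have o0 : 0 < oneDsqr x by exact: lt_le_trans (oneDsqr_ge1 x).
rewrite lef_pV2 ?posrE ?expR_gt0// ?mulr_gt0 ?invr_gt0//.
have := @expR_ge1Dxn R `|x| 1 (normr_ge0 _).
rewrite real_normK ?num_real// (_ : 2`! = 2)%N// /oneDsqr.
by move: (sqr_ge0 x) (expR _) => + e; move: (x ^+ 2) => s; lra.
Qed.

Lemma continuous_expR_Nsum n :
  continuous (fun y : 'rV[R]_n => expR (- \sum_i `|y 0 i|)).
Proof.
apply: continuous_rV => y I F FF h hy; apply: cvg_expR.
apply: cvgN; apply: cvg_big => [|i _]; first exact: add_continuous.
by apply: cvg_norm; exact: cvg_coord hy.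
Qed.

Lemma integral_expR_Nsum_lty n :
  (\int[@lebesgue_rV R n]_y (expR (- \sum_i `|(y : 'rV[R]_n) 0 i|))%:E < +oo)%E.
Proof.
have mN m : measurable_fun setT (fun y : 'rV[R]_m =>
  (expR (- \sum_i `|y 0 i|))%:E).
  apply/measurable_EFinP; apply: continuous_measurable_rV.
  exact: continuous_expR_Nsum.
elim: n => [|n IH].
  rewrite (@eq_integral _ _ _ _ _ (cst 1%E)); last first.
    by move=> y _; rewrite big_ord0 oppr0 expR0.
  by rewrite integral_cst// mul1e /= diracE in_setT ltry.
have H := ge0_integral_rV_cons (mN n.+1) _.
rewrite {}H; last by move=> y; rewrite lee_fin expR_ge0.
have E (x : R) : (\int[lebesgue_rV n]_v
    (expR (- \sum_i `|(rV_cons (x, v) : 'rV_n.+1) 0 i|))%:E =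
    (expR (- `|x|))%:E * \int[lebesgue_rV n]_v (expR (- \sum_i `|v 0 i|))%:E)%E.
  rewrite -ge0_integralZl//; last exact: mN.
  apply: eq_integral => v _; rewrite -EFinM -expRD -opprD big_ord_recl rV_cons0.
  by under eq_bigr do rewrite rV_consS.
under eq_integral do rewrite E.
set K := (\int[lebesgue_rV n]_v _)%E in IH *.
have K0 : (0 <= K)%E by apply: integral_ge0 => v _; rewrite lee_fin expR_ge0.
have KE : K = (fine K)%:E by rewrite fineK// ge0_fin_numE.
rewrite KE; under eq_integral do rewrite muleC.
rewrite ge0_integralZl//.
- by rewrite lte_mul_pinfty// ?integral_expR_Nabs_lty// ?lee_fin ?fine_ge0.
- apply/measurable_EFinP; apply: continuous_measurable_fun.
  move=> x; apply: cvg_expR.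
  by apply: cvgN; exact: norm_continuous.
- by rewrite lee_fin fine_ge0.
Qed.

End exponential_integrable.

(** * Regularization *)

Section dilation.
Context {R : realType} (n : nat) (t : R) (y0 : 'rV[R]_n).
Hypothesis t0 : 0 < t.

Local Notation T := (fun y : 'rV[R]_n => y0 + t *: (y - y0)).

Lemma dilation_C1 : C1_map T (fun=> t%:M).
Proof.
split.
- move=> i; apply: continuous_rV => z I F FF h hz.
  have E (w : 'rV[R]_n) : T w 0 i = y0 0 i + t * (w 0 i - y0 0 i).
    by rewrite !mxE.
  under eq_fun do rewrite E; rewrite E.
  apply: cvgD; first exact: cvg_cst.
  apply: cvgM; first exact: cvg_cst.
  by apply: cvgB; [exact: cvg_coord hz|exact: cvg_cst].
- move=> x i j; apply/is_deriveP.
  have E : (fun=> t *+ (i == j)) @ (0 : R)^' --> (t%:M : 'M[R]_n) i j.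
    by rewrite !mxE; exact: cvg_cst.
  apply: cvg_trans E; apply: near_eq_cvg; near=> h.
  have h0 : h != 0 by near: h; exact: nbhs_dnbhs_neq.
  by rewrite !mxE eqxx /=; case: (i == j); rewrite ?mulr1n ?mulr0n; field.
- by move=> i j; exact: cst_continuous.
Unshelve. all: by end_near. Qed.

Lemma ge0_integral_dilation (G : 'rV[R]_n -> \bar R) :
  measurable_fun setT G -> (forall x, 0 <= G x)%E ->
  (\int[lebesgue_rV n]_y G y =
   (t ^+ n)%:E * \int[lebesgue_rV n]_y G (y0 + t *: (y - y0))%R)%E.
Proof.
move=> mG G0.
have Tm : strongly_monotone t T.
  move=> x y; rewrite (_ : T x - T y = t *: (x - y)) ?dotZl//.
  by apply/rowP => i; rewrite !mxE; ring.
have [_ /(_ G mG G0) <-] := ge0_change_of_variables t0 dilation_C1 Tm.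
rewrite -ge0_integralZl//.
- by apply: eq_integral => x _; rewrite det_scalar muleC.
- exact: (measurableT_comp mG (measurable_C1_map dilation_C1)).
- by rewrite lee_fin exprn_ge0// ltW.
Qed.

End dilation.

Section box.
Context {R : realType} (n : nat).
Definition box (r : R) : set 'rV[R]_n :=
  [set v | forall i, `[- r, r]%classic (v 0 i)].

Lemma compact_box r : compact (box r).
Proof.
by apply: (@rV_compact _ _ (fun=> `[- r, r]%classic)) => i;
  exact: segment_compact.
Qed.

Lemma measurable_box r : measurable (box r).
Proof.
rewrite (_ : box r = \bigcap_(i in [set: 'I_n])
   ((fun v : 'rV[R]_n => v 0 i) @^-1` `[- r, r]%classic)).
  apply: fin_bigcap_measurable => // i _; rewrite -[X in measurable X]setTI.
  by apply: measurable_coord => //; exact: measurable_itv.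
by apply/seteqP; split=> [x xe i _|x xe i]; exact: xe.
Qed.

Lemma lebesgue_rV_cube r : 0 < r -> lebesgue_rV n (box r) = ((r + r) ^+ n)%:E.
Proof.
move=> r0.
have mA (i : 'I_n) : measurable (`[- r, r]%classic : set (measurableTypeR R)).
  exact: measurable_itv.
rewrite [LHS](lebesgue_rV_box mA) -[n in RHS]card_ord -prodr_const.
apply: (big_ind2 (fun (x : \bar R) (y : R) => x = y%:E)) => //.
  by move=> x1 x2 y1 y2 -> ->; rewrite EFinM.
move=> i _; rewrite lebesgue_measure_itv/= lte_fin ifT ?opprK//.
by rewrite (lt_trans _ r0)// oppr_lt0.
Qed.

End box.

Section regularization.
Context {R : realType} (n : nat) (psi : 'rV[R]_n -> R)
  (g : 'rV[R]_n -> 'rV[R]_n) (H : 'rV[R]_n -> 'M[R]_n).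
Hypothesis scv : strictly_convex psi.
Hypothesis dpsi : forall x i,
  is_derive x (delta_mx 0 i : 'rV[R]_n) psi (g x 0 i).
Hypothesis cpsi : continuous psi.
Hypothesis CG : C1_map g H.

Local Notation mu := (@lebesgue_rV R n).

(** Adding e |x|^2 / 2 makes the gradient e-strongly monotone; reg_grad and
reg_Hess are the gradient and the Hessian matrix of reg. *)
Definition reg e x := psi x + e / 2 * dot x x.
Definition reg_grad e x := g x + e *: x.
Definition reg_Hess e x := H x + e%:M.
Definition reg_dual e := dual (fun x => expR (- reg e x)).
(** The density obtained from reg_dual e by the substitution
y = reg_grad e x. *)
Definition reg_pullback e x :=
  expR (reg e x - dot (reg_grad e x) x) * \det (reg_Hess e x).

Lemma reg_grad_C1 e : C1_map (reg_grad e) (reg_Hess e).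
Proof.
have [cg dg cH] := CG; split.
- move=> i; apply: continuous_rV => z I F FF h hz; rewrite /reg_grad.
  under eq_fun do rewrite mxE [X in _ + X]mxE; rewrite mxE [X in _ + X]mxE.
  apply: cvgD; first exact: (cvg_comp _ _ hz (cg i z)).
  apply: cvgM; first exact: cvg_cst.
  exact: cvg_coord hz.
- move=> x i j; apply/is_deriveP; have /is_deriveP dx := dg x i j.
  have E : h^-1 * (g (x + h *: delta_mx 0 j) 0 i - g x 0 i) + e *+ (i == j)
      @[h --> (0 : R)^'] --> reg_Hess e x i j.
    by rewrite !mxE; apply: cvgD => //; exact: cvg_cst.
  apply: cvg_trans E; apply: near_eq_cvg; near=> h.
  have h0 : h != 0 by near: h; exact: nbhs_dnbhs_neq.
  by rewrite /reg_grad !mxE eqxx /=; case: (i == j); rewrite ?mulr1n ?mulr0n;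
    field.
- move=> i j; apply: continuous_rV => z I F FF h hz; rewrite /reg_Hess.
  under eq_fun do rewrite mxE; rewrite mxE.
  apply: cvgD; last exact: cvg_cst.
  exact: (cvg_comp _ (fun z => H z i j) hz (cH i j z)).
Unshelve. all: by end_near. Qed.

Lemma reg_grad_strongly_monotone e : strongly_monotone e (reg_grad e).
Proof.
move=> x y; rewrite /reg_grad opprD addrACA -scalerBr [in leRHS]dotDl dotZl
  lerDr.
exact: (grad_monotone scv dpsi).
Qed.

Lemma reg_tangent e x z : 0 <= e ->
  reg e x + dot (reg_grad e x) (z - x) <= reg e z.
Proof.
move=> e0; have := tangent_le scv dpsi x z; rewrite /reg /reg_grad dotDl dotZl.
have := dot_ge0 (z - x); rewrite !dotBr !dotBl [dot z x]dotC => h1 h2.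
by have : 0 <= e * (dot z z - dot x z - (dot x z - dot x x))
  by [exact: mulr_ge0]; lra.
Qed.

Lemma reg_dual_grad e x : 0 <= e ->
  reg_dual e (reg_grad e x) = expR (reg e x - dot (reg_grad e x) x).
Proof. by move=> e0; apply: dual_subgradient => z; exact: reg_tangent. Qed.

Lemma cvg_reg_Hess_det x e :
  (fun t => \det (reg_Hess t x)) @ e --> \det (reg_Hess e x).
Proof.
move: e; apply: continuous_det => i j; rewrite /reg_Hess => e.
rewrite /continuous_at; under eq_fun do rewrite !mxE; rewrite !mxE.
apply: cvgD; first exact: cvg_cst.
by case: (i == j); [rewrite mulr1n; exact: cvg_id|rewrite mulr0n;
  exact: cvg_cst].
Qed.

(** Positive for e > 0 by the change of variables, and a limit of such values
at 0. *)
Lemma reg_Hess_det_ge0 e x : 0 <= e -> 0 <= \det (reg_Hess e x).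
Proof.
rewrite le_eqVlt => /orP[/eqP <-|e0]; last first.
  by apply/ltW; apply: (ge0_change_of_variables e0 (reg_grad_C1 e)
    (@reg_grad_strongly_monotone e)).1.
apply: (@cvgr_to_ge _ _ _ _ _ _ _ (cvg_at_right_filter (@cvg_reg_Hess_det x
  0))).
near=> t; have t0 : 0 < t by near: t; exact: nbhs_right_gt.
by apply/ltW; apply: (ge0_change_of_variables t0 (reg_grad_C1 t)
  (@reg_grad_strongly_monotone t)).1.
Unshelve. all: by end_near. Qed.

Lemma reg_pullback_ge0 e x : 0 <= e -> 0 <= reg_pullback e x.
Proof. by move=> e0; rewrite mulr_ge0 ?expR_ge0// reg_Hess_det_ge0. Qed.

Lemma integral_reg_pullback e : 0 < e ->
  (\int[mu]_x (reg_pullback e x)%:E = \int[mu]_y (reg_dual e y)%:E)%E.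
Proof.
move=> e0; have [_ /(_ (EFin \o reg_dual e)) <-] :=
  ge0_change_of_variables e0 (reg_grad_C1 e) (@reg_grad_strongly_monotone e).
- apply: eq_integral => x _; rewrite /reg_pullback EFinM /=.
  by rewrite reg_dual_grad// ltW.
- by apply/measurable_EFinP; exact: measurable_dual.
- by move=> y; rewrite lee_fin dual_ge0.
Qed.

Lemma continuous_reg_pullback e : continuous (reg_pullback e).
Proof.
have [cT _ cJ] := reg_grad_C1 e; apply: continuous_rV => z I F FF h hz.
have cx i : h t 0 i @[t --> F] --> z 0 i by exact: cvg_coord hz.
apply: cvgM; last first.
  exact: (cvg_comp _ _ hz (@continuous_det _ _ _ (reg_Hess e) cJ z)).
apply: cvg_expR.
apply: cvgB.
  apply: cvgD; first exact: (cvg_comp _ _ hz (@cpsi z)).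
  by apply: cvgM; [exact: cvg_cst|exact: cvg_dot].
by apply: cvg_dot => // i; exact: (cvg_comp _ _ hz (cT i z)).
Qed.

Lemma cvg_reg_pullback x e :
  (fun t => reg_pullback t x) @ e --> reg_pullback e x.
Proof.
have E (t : R) : reg t x - dot (reg_grad t x) x = psi x - dot (g x)
  x - t / 2 * dot x x.
  by rewrite /reg /reg_grad dotDl dotZl; field.
rewrite /reg_pullback; under eq_fun do rewrite E; rewrite E.
apply: cvgM; last exact: cvg_reg_Hess_det.
apply: cvg_expR.
apply: cvgB; first exact: cvg_cst.
by apply: cvgM; [apply: cvgM; [exact: cvg_id|]|]; exact: cvg_cst.
Qed.

(** The dual functions decrease to their limit: a point that nearly realizes
the infimum for e = 0 does so for small e. *)
Lemma reg_dual_cvg (u : R^nat) y :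
  (forall k, 0 <= u k) -> u @ \oo --> (0 : R) ->
  (fun k => reg_dual (u k) y) @ \oo --> reg_dual 0 y.
Proof.
move=> u0 cu; apply/cvgrPdist_lt => d d0.
have [z zP] : exists z, expR (reg 0 z - dot y z) < reg_dual 0 y + d.
  by apply/dual_ltP; rewrite ltrDl.
have cz : (fun k => expR (reg (u k) z - dot y z)) @ \oo -->
  expR (reg 0 z - dot y z).
  apply: cvg_expR.
  apply: cvgB; last exact: cvg_cst.
  apply: cvgD; first exact: cvg_cst.
  by apply: cvgMr_tmp; apply: cvgMr_tmp.
near=> k.
have h1 : expR (reg (u k) z - dot y z) < reg_dual 0 y + d.
  by near: k; exact: (cvgr_lt _ cz).
have h2 := dual_le (reg (u k)) y z.
have h3 : reg_dual 0 y <= reg_dual (u k) y.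
  apply: dual_mono => w; rewrite /reg lerD2l mul0r mul0r mulr_ge0 ?dot_ge0//.
  by rewrite divr_ge0.
rewrite distrC ger0_norm ?subr_ge0// ltrBlDl.
exact: le_lt_trans h2 h1.
Unshelve. all: by end_near. Qed.

Local Notation G := reg_dual.
Local Notation h := reg_pullback.

Let D x := dot (g x - g 0) x.

Let D_ge0 x : 0 <= D x.
Proof. by have := grad_monotone scv dpsi x 0; rewrite subr0. Qed.

Let h_ge0 e x : 0 <= e -> 0 <= h e x.
Proof. exact: reg_pullback_ge0. Qed.

Let mh e : measurable_fun setT (fun x => (h e x)%:E).
Proof.
apply/measurable_EFinP; apply: continuous_measurable_rV.
exact: continuous_reg_pullback.
Qed.

Let mG e : measurable_fun setT (fun x => (G e x)%:E).
Proof. by apply/measurable_EFinP; exact: measurable_dual. Qed.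

Let cD : continuous D.
Proof.
have [cg _ _] := CG; apply: continuous_rV => z I F FF u uz; rewrite /D /dot.
apply: cvg_big => [|i _]; first exact: add_continuous.
under eq_fun do rewrite mxE [X in _ + X]mxE; rewrite mxE [X in _ + X]mxE.
apply: cvgM; last exact: cvg_coord uz.
by apply: cvgB; [exact: (cvg_comp _ _ uz (cg i z))|exact: cvg_cst].
Qed.

Let cexpD t : continuous (fun x => expR (- (t * D x))).
Proof.
apply: continuous_rV => z I F FF u uz.
apply: cvg_expR.
apply: cvgN; apply: cvgM; first exact: cvg_cst.
exact: (cvg_comp _ _ uz (@cD z)).
Qed.

Let mhD e t : measurable_fun setT (fun x => (h e x * expR (- (t * D x)))%:E).
Proof.
apply/measurable_EFinP; apply: measurable_funM.
  by apply/measurable_EFinP; exact: mh.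
apply: continuous_measurable_rV; exact: cexpD.
Qed.

(** The dual function of reg e is integrated after the dilation about g 0 and
the substitution y = reg_grad e x. Testing the infimum at x itself bounds the
dilated dual function at reg_grad e x by its value there times exp (- (t - 1)
<reg_grad e x - g 0, x>), and <reg_grad e x - g 0, x> = D x + e |x|^2. *)
Lemma dilated_dual_le e t : 0 < e -> 1 <= t ->
  (\int[mu]_y (G e y)%:E <=
   (t ^+ n)%:E * \int[mu]_x (h e x * expR (- ((t - 1) * D x)))%:E)%E.
Proof.
move=> e0 t1; have t0 : 0 < t by apply: lt_le_trans t1.
rewrite (ge0_integral_dilation (g 0) t0 (mG e)); last first.
  by move=> y; rewrite lee_fin dual_ge0.
rewrite lee_wpmul2l ?lee_fin ?exprn_ge0 ?(ltW t0)//.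
have mF := measurable_C1_map (dilation_C1 t (g 0)).
have mGF : measurable_fun setT (fun y : 'rV[R]_n =>
  (G e (g 0 + t *: (y - g 0)))%:E).
  exact: (measurableT_comp (mG e) mF).
have [det0 CV] := ge0_change_of_variables e0 (reg_grad_C1 e)
  (@reg_grad_strongly_monotone e).
rewrite -(CV _ mGF); last (move=> y; rewrite lee_fin; exact: dual_ge0).
apply: ge0_le_integral => //.
- by move=> x _; rewrite mule_ge0// lee_fin ?dual_ge0// ltW.
- apply: emeasurable_funM; first exact: (measurableT_comp mGF
  (measurable_C1_map (reg_grad_C1 e))).
  apply/measurable_EFinP; apply: continuous_measurable_rV;
    apply: continuous_det.
  by have [] := reg_grad_C1 e.
move=> x _; rewrite -EFinM lee_fin /reg_pullback mulrAC.
apply: ler_wpM2r; first exact: ltW.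
apply: (le_trans (dual_le _ _ x)); rewrite -expRD ler_expR /reg_grad /D.
rewrite !(dotDl, dotZl, dotNl).
have := dot_ge0 x => xx.
have : 0 <= (t - 1) * (e * dot x x) by rewrite !mulr_ge0 ?subr_ge0// ltW.
lra.
Qed.

(** The weight exp (- (t - 1) D x) is at most 1 on the box and at most exp (-
(t - 1) K) outside. *)
Lemma dilated_dual_split e t r K : 0 < e -> 1 <= t ->
  (forall (x : 'rV[R]_n) i, r < `|x 0 i| -> K <= D x) ->
  (\int[mu]_y (G e y)%:E <=
   (t ^+ n)%:E * (\int[mu]_(x in box r) (h e x)%:E +
                  (expR (- ((t - 1) * K)))%:E * \int[mu]_y (G e y)%:E))%E.
Proof.
move=> e0 t1 rK; have t0 : 0 < t by apply: lt_le_trans t1.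
apply: (le_trans (dilated_dual_le e0 t1)).
rewrite lee_wpmul2l ?lee_fin ?exprn_ge0 ?(ltW t0)//.
rewrite -(integral_reg_pullback e0).
rewrite [(\int[_]_(_ in box r) _)%E]integral_mkcond.
have mb : measurable_fun setT ((fun x => (h e x)%:E) \_ (box r)).
  by apply/(measurable_restrictT _ (measurable_box r)); exact: measurable_funTS.
have h0 x : (0 <= (h e x)%:E)%E by rewrite lee_fin h_ge0// ltW.
have b0 x : (0 <= ((fun x => (h e x)%:E) \_ (box r)) x)%E.
  by rewrite /patch; case: ifP.
have K0 : (0 <= (expR (- ((t - 1) * K)))%:E)%E by rewrite lee_fin expR_ge0.
have mKh : measurable_fun setT (fun x => ((expR (- ((t - 1)
  * K)))%:E * (h e x)%:E)%E).
  exact: emeasurable_funM.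
have Kh0 x : (0 <= (expR (- ((t - 1) * K)))%:E * (h e x)%:E)%E
  by exact: mule_ge0.
rewrite -(ge0_integralZl _ measurableT (mh e) (fun x _ => h0 x) K0).
rewrite -(ge0_integralD _ measurableT (fun x _ => b0 x) mb (fun x _ => Kh0 x)
  mKh).
apply: ge0_le_integral => //.
- by move=> x _; rewrite lee_fin mulr_ge0 ?expR_ge0// h_ge0// ltW.
- exact: emeasurable_funD.
move=> x _; have {}h0 : 0 <= h e x := h0 x.
rewrite /patch; case: ifPn => xr.
  rewrite -EFinM -EFinD lee_fin.
  have e1 : expR (- ((t - 1) * D x)) <= 1.
    by rewrite expR_le1 oppr_le0 mulr_ge0 ?subr_ge0.
  rewrite (@le_trans _ _ (h e x))//; first by rewrite ler_piMr.
  by rewrite lerDl mulr_ge0// expR_ge0.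
rewrite add0e -EFinM lee_fin mulrC ler_wpM2r// ler_expR lerN2 ler_wpM2l
  ?subr_ge0//.
move: xr; rewrite notin_setE => /existsNP[i /= ri].
apply: (rK x i); rewrite ltNge; apply/negP => xi; apply: ri.
by rewrite in_itv/= -ler_norml.
Qed.

Let u : R^nat := fun k => k.+1%:R^-1.

Let u_gt0 k : 0 < u k. Proof. by rewrite invr_gt0. Qed.

Let u_le1 k : u k <= 1. Proof. by rewrite invf_le1// ler1n. Qed.

Let cvg_u : u @ \oo --> (0 : R). Proof. exact: cvg_harmonic. Qed.

(** Dominated by the dual function for e = 1, which dual_bound controls. *)
Lemma cvg_integral_reg_dual :
  mu.-integrable setT (EFin \o G 0) /\
  (\int[mu]_y (G (u k) y)%:E @[k --> \oo] --> \int[mu]_y (G 0 y)%:E)%E.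
Proof.
have [C C0 CP] := dual_bound (reg 1).
have mQ : measurable_fun setT (fun y : 'rV[R]_n => expR (- \sum_i `|y 0 i|)).
  by apply: continuous_measurable_rV; exact: continuous_expR_Nsum.
have iQ : mu.-integrable setT (fun y : 'rV[R]_n =>
  (C * expR (- \sum_i `|y 0 i|))%:E).
  apply/integrableP; split; first by apply/measurable_EFinP;
    exact: measurable_funM.
  under eq_integral do rewrite gee0_abs ?lee_fin ?mulr_ge0 ?expR_ge0// EFinM.
  rewrite ge0_integralZl//.
  - rewrite lte_mul_pinfty// ?integral_expR_Nsum_lty// lee_fin.
  - exact/measurable_EFinP.
have cvgG : {ae mu, forall y, setT y -> (G (u k) y)%:E @[k --> \oo] -->
  (EFin \o G 0) y}.
  apply: aeW => y _; apply: cvg_EFin; first exact: nearW.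
  exact: reg_dual_cvg (fun k => ltW (u_gt0 k)) cvg_u.
have leG : {ae mu, forall y k, setT y ->
    (`|(G (u k) y)%:E| <= (C * expR (- \sum_i `|y 0 i|))%:E)%E}.
  apply: aeW => y k _; rewrite gee0_abs ?lee_fin ?dual_ge0//.
  apply: le_trans (CP y); apply: dual_mono => z; rewrite /reg lerD2l.
  by rewrite ler_wpM2r ?dot_ge0// ler_pM2r.
by have [i1 _ i2] := dominated_convergence measurableT (fun k => mG (u k))
  (mG 0) cvgG iQ leG.
Qed.

(** Dominated on the compact box by the maximum of a continuous function B,
which is obtained by expanding the determinant and bounding e by 1. *)
Lemma cvg_box_integral_reg_pullback r : 0 < r ->
  (\int[mu]_(x in box r) (h (u k) x)%:E @[k --> \oo] -->
   \int[mu]_(x in box r) (h 0 x)%:E)%E.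
Proof.
move=> r0; have [cg dg cH] := CG.
pose B x := expR (psi x - dot (g x) x) * \sum_(s : {perm 'I_n}) \prod_(i < n)
  (`|H x i (s i)| + 1).
have cB : continuous B.
  apply: continuous_rV => z I F FF v vz; apply: cvgM.
    apply: cvg_expR.
    apply: cvgB; first exact: (cvg_comp _ _ vz (@cpsi z)).
    apply: cvg_big => [|i _]; first exact: add_continuous.
    apply: cvgM; first exact: (cvg_comp _ _ vz (cg i z)).
    exact: cvg_coord vz.
  apply: cvg_big => [|s _]; first exact: add_continuous.
  apply: cvg_big => [|i _]; first exact: mul_continuous.
  apply: cvgD; last exact: cvg_cst.
  apply: cvg_norm; exact: (cvg_comp _ (fun z => H z i (s i)) vz (cH _ _ z)).
have b0 : @box R n r !=set0.
  by exists 0 => i /=; rewrite mxE in_itv/= oppr_le0 ltW.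
have [m _ mmax] := EVT_max_rV b0 (@compact_box _ _ r) (continuous_subspaceT cB).
have hB k x : `|h (u k) x| <= B x.
  rewrite /reg_pullback normrM ger0_norm ?expR_ge0//; apply: ler_pM => //.
    rewrite ler_expR /reg /reg_grad dotDl dotZl.
    by have := mulr_ge0 (ltW (u_gt0 k)) (dot_ge0 x); lra.
  apply: (le_trans (ler_norm_sum _ _ _)); apply: ler_sum => s _.
  rewrite normrM normrX normrN1 expr1n mul1r normr_prod.
  apply: ler_prod => i _; rewrite normr_ge0/= !mxE (le_trans (ler_normD _ _))//
    lerD2l.
  case: (i == s i); rewrite ?mulr1n ?mulr0n ?normr0 ?ler01//.
  by rewrite gtr0_norm.
have iB : mu.-integrable (box r) (cst (B m)%:E).
  apply/integrableP; split; first exact: measurable_cst.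
  rewrite integral_cst; last exact: measurable_box.
  rewrite lte_mul_pinfty// ?abse_ge0//.
  by rewrite [X in (X < _)%E](lebesgue_rV_cube n r0) ltry.
have cvgh : {ae mu, forall x, box r x -> (h (u k) x)%:E @[k --> \oo] -->
  (h 0 x)%:E}.
  apply: aeW => x _; apply: cvg_EFin; first exact: nearW.
  exact: (cvg_comp _ _ cvg_u (@cvg_reg_pullback x 0)).
have leh : {ae mu, forall x k, box r x ->
  (`|(h (u k) x)%:E| <= cst (B m)%:E x)%E}.
  apply: aeW => x k xr; rewrite lee_fin (le_trans (hB k x))//.
  by apply: mmax; rewrite inE.
by have [_ _ i2] := dominated_convergence (measurable_box r)
  (fun k => measurable_funTS (mh (u k))) (measurable_funTS (mh 0)) cvgh iB leh.
Qed.

Lemma reg_pullback_fatou :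
  (\int[mu]_x (h 0 x)%:E <= \int[mu]_y (G 0 y)%:E)%E.
Proof.
have [_ cI] := cvg_integral_reg_dual.
have F := @fatou _ _ _ mu setT measurableT (fun k x => (h (u k) x)%:E)
  (fun k => mh (u k)).
have {F} := F (fun k x _ => h_ge0 x (ltW (u_gt0 k))).
rewrite (_ : (fun k => _) = (fun k => \int[mu]_y (G (u k) y)%:E)%E); last first.
  by apply/funext => k; exact: integral_reg_pullback.
rewrite (cvg_limn_einf_sup cI).1 => F; apply: le_trans F.
rewrite le_eqVlt; apply/orP; left; apply/eqP; apply: eq_integral => x _.
apply/esym/(cvg_limn_einf_sup _).1; apply: cvg_EFin; first exact: nearW.
exact: (cvg_comp _ _ cvg_u (@cvg_reg_pullback x 0)).
Qed.

(** The limit e -> 0 of dilated_dual_split for the dilation factor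
t = 1 + s. *)
Lemma integral_dual_bound s : 0 < s ->
  (\int[mu]_y (G 0 y)%:E <= ((1 + s) ^+ n)%:E *
    (\int[mu]_x (h 0 x)%:E + s%:E * \int[mu]_y (G 0 y)%:E))%E.
Proof.
move=> s0; have [iG cI] := cvg_integral_reg_dual.
(* K = 1 / s^2 makes the weight outside the box at most exp (- 1 / s) <= s. *)
have [r r0 rK] := grad_coercive scv dpsi cpsi (s ^- 2).
have t1 : 1 <= 1 + s by rewrite lerDl ltW.
have I0 : (0 <= \int[mu]_y (G 0 y)%:E)%E.
  by apply: integral_ge0 => y _; rewrite lee_fin dual_ge0.
have Ifin : (\int[mu]_y (G 0 y)%:E)%E \is a fin_num
  by exact: integrable_fin_num iG.
have B0 e (e0 : 0 <= e) : (0 <= \int[mu]_(x in box r) (h e x)%:E)%E.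
  by apply: integral_ge0 => x _; rewrite lee_fin h_ge0.
have Ble : (\int[mu]_(x in box r) (h 0 x)%:E <= \int[mu]_x (h 0 x)%:E)%E.
  apply: ge0_subset_integral => //; first exact: measurable_box.
  by move=> x _; rewrite lee_fin h_ge0.
have Bfin : (\int[mu]_(x in box r) (h 0 x)%:E)%E \is a fin_num.
  rewrite ge0_fin_numE ?B0// (le_lt_trans Ble)// (le_lt_trans
    reg_pullback_fatou)//.
  by rewrite ltey_eq Ifin.
have sE : expR (- ((1 + s - 1) * s ^- 2)) <= s.
  rewrite addrAC subrr add0r expRN -[leRHS]invrK lef_pV2 ?posrE ?expR_gt0
    ?invr_gt0//.
  apply: le_trans (expR_ge1Dx _); rewrite (_ : s * _ = s^-1) ?lerDr//.
  by rewrite expr2; field; rewrite gt_eqF.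
have step k : (\int[mu]_y (G (u k) y)%:E <= ((1 + s) ^+ n)%:E *
   (\int[mu]_(x in box r) (h (u k) x)%:E + s%:E * \int[mu]_y (G (u k) y)%:E))%E.
  have S := dilated_dual_split (u_gt0 k) t1 rK.
  apply: (le_trans S); apply: lee_wpmul2l.
    by rewrite lee_fin exprn_ge0 ?addr_ge0 ?(ltW s0).
  apply: leeD2l; apply: lee_wpmul2r; last by rewrite lee_fin.
  by apply: integral_ge0 => y _; rewrite lee_fin dual_ge0.
have cR : (((1 + s) ^+ n)%:E *
   (\int[mu]_(x in box r) (h (u k) x)%:E + s%:E * \int[mu]_y (G (u k) y)%:E)
     @[k --> \oo]
   --> ((1 + s) ^+ n)%:E *
   (\int[mu]_(x in box r) (h 0 x)%:E + s%:E * \int[mu]_y (G 0 y)%:E))%E.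
  apply: cvgeZl => //; apply: cvgeD.
  - by rewrite fin_num_adde_defr// fin_numM.
  - exact: cvg_box_integral_reg_pullback.
  - exact: cvgeZl.
apply: (@le_trans _ _ (((1 + s) ^+ n)%:E *
   (\int[mu]_(x in box r) (h 0 x)%:E + s%:E * \int[mu]_y (G 0 y)%:E))%E).
  apply: (lee_cvg_to cI cR); exact: nearW step.
apply: lee_wpmul2l; first by rewrite lee_fin exprn_ge0 ?addr_ge0 ?(ltW s0).
exact: leeD2r.
Qed.

Theorem integral_dual_eq_pullback :
  (\int[mu]_y (G 0 y)%:E = \int[mu]_x (h 0 x)%:E)%E.
Proof.
have [iG cI] := cvg_integral_reg_dual.
have Ifin : (\int[mu]_y (G 0 y)%:E)%E \is a fin_num
  by exact: integrable_fin_num iG.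
apply/eqP; rewrite eq_le reg_pullback_fatou andbT.
have afin : (\int[mu]_x (h 0 x)%:E)%E \is a fin_num.
  rewrite ge0_fin_numE ?(le_lt_trans reg_pullback_fatou) ?ltey_eq ?Ifin//.
  by apply: integral_ge0 => x _; rewrite lee_fin h_ge0.
have B := integral_dual_bound; rewrite -(fineK Ifin) -(fineK afin) in B *.
rewrite lee_fin; move: (fine _) (fine _) B => b a B.
have cB : (fun s => (1 + s) ^+ n * (b + s * a)) @ (0 : R)^'+ -->
  (1 + 0) ^+ n * (b + 0 * a).
  apply: cvg_at_right_filter; apply: cvgM.
    apply: (@cvg_comp _ _ _ (fun s : R => 1 + s) (fun y : R => y ^+ n));
      last exact: exprn_continuous.
    by apply: cvgD; [exact: cvg_cst|exact: cvg_id].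
  by apply: cvgD; [exact: cvg_cst|apply: cvgMr_tmp; exact: cvg_id].
rewrite addr0 expr1n mul1r mul0r addr0 in cB.
apply: (@cvgr_to_ge _ _ _ _ _ _ _ cB); near=> s.
by rewrite -lee_fin EFinM EFinD EFinM; apply: B; near: s; exact: nbhs_right_gt.
Unshelve. all: by end_near. Qed.

End regularization.

(** * Jensen's inequality on the half-line *)

Section convex_half_line.
Context {R : realType} (f : R -> R).
Hypothesis cf : convex_function (`]0, +oo[%classic : set R) f.

Lemma convex_half_lineP t x y : 0 <= t <= 1 -> 0 < x -> 0 < y ->
  f (t * x + (1 - t) * y) <= t * f x + (1 - t) * f y.
Proof.
move=> /andP[t0 t1] x0 y0; have := @cf (Itv01 t0 t1) x y.
by rewrite !inE/= !in_itv/= !andbT => /(_ x0 y0); rewrite !convRE.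
Qed.

(** The slope a is the supremum of the slopes of the chords to the left of t0;
these are at most the slopes of the chords to the right. *)
Lemma supporting_line t0 : 0 < t0 ->
  exists a, forall t, 0 < t -> f t0 + a * (t - t0) <= f t.
Proof.
move=> t0_gt0; pose S := [set (f t0 - f s) / (t0 - s) | s in `]0, t0[%classic].
have slopes s r : 0 < s -> s < t0 -> t0 < r ->
    (f t0 - f s) / (t0 - s) <= (f r - f t0) / (r - t0).
  move=> s0 st rt; have sr : 0 < r - s by lra.
  have T01 : 0 <= (r - t0) / (r - s) <= 1.
    by rewrite divr_ge0 ?ler_pdivrMr// ?mul1r; lra.
  have := convex_half_lineP T01 s0 (lt_trans s0 (lt_trans st rt)).
  rewrite (_ : _ * s + _ = t0); last by field; rewrite gt_eqF.
  have -> : 1 - (r - t0) / (r - s) = (t0 - s) / (r - s) by field;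
    rewrite gt_eqF.
  have E (a b : R) : a / (r - s) * b * (r - s) = a * b by field; rewrite gt_eqF.
  rewrite -(ler_pM2r sr) mulrDl !E => H.
  rewrite ler_pdivrMr ?subr_gt0// mulrAC ler_pdivlMr ?subr_gt0//.
  lra.
have S0 : S !=set0.
  by exists ((f t0 - f (t0 / 2)) / (t0 - t0 / 2)); exists (t0 / 2) => //=;
    rewrite in_itv/=; lra.
have Sub r : t0 < r -> ubound S ((f r - f t0) / (r - t0)).
  move=> tr y [s]; rewrite /= in_itv/= => /andP[s0 st] <-; exact: slopes.
exists (sup S) => t t_gt0; have [tt|tt|->] := ltgtP t t0.
- have : (f t0 - f t) / (t0 - t) <= sup S.
    apply: ub_le_sup; first by exists ((f (t0 + 1) - f t0) / (t0 + 1 - t0));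
      apply: Sub; lra.
    by exists t => //=; rewrite in_itv/= t_gt0.
  by rewrite ler_pdivrMr ?subr_gt0//; lra.
- have : sup S <= (f t - f t0) / (t - t0) by apply: ge_sup => //; exact: Sub.
  by rewrite ler_pdivlMr ?subr_gt0//; lra.
- by rewrite subrr mulr0 addr0.
Qed.

Lemma ext0_pos (k : R -> R) t : 0 < t -> ext0 k t = (k t)%:E.
Proof. by move=> t0; rewrite /ext0 gt_eqF. Qed.

(** Subtracting the supporting line at 1 leaves a nonnegative convex function
that vanishes at 1, hence is nonincreasing on ]0, 1[ and has a limit at 0,
possibly infinite. *)
Lemma cvg_ext0 : (f s)%:E @[s --> (0 : R)^'+] --> ext0 f 0.
Proof.
have [a aP] := supporting_line ltr01.
pose k s := f s - (f 1 + a * (s - 1)).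
have k0 s : 0 < s -> 0 <= k s by move=> /aP; rewrite /k; lra.
have ndk : {in Interval (BRight (0 : R)) (BLeft 1) &,
  nonincreasing_fun (EFin \o k)}.
  move=> x y; rewrite !in_itv/= => /andP[x0 x1] /andP[y0 y1] xy;
    rewrite lee_fin.
  have x1' : 0 < 1 - x by lra.
  have T01 : 0 <= (1 - y) / (1 - x) <= 1.
    by rewrite divr_ge0 ?ler_pdivrMr// ?mul1r; lra.
  have := convex_half_lineP T01 x0 ltr01.
  rewrite (_ : _ * x + _ = y); last by field; rewrite gt_eqF.
  move=> H; have kx := k0 x x0.
  have : ((1 - y) / (1 - x)) * k x <= k x by rewrite ler_piMl//;
    case/andP : T01.
  apply: le_trans; rewrite /k.
  have E : (1 - y) / (1 - x) * (x - 1) = y - 1.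
    by field; rewrite gt_eqF.
  move: H E; set T := _ / _ => H E.
  have : T * (a * (x - 1)) = a * (y - 1) by rewrite mulrCA E.
  by lra.
have ck := @nonincreasing_at_right_cvge _ (EFin \o k) 0 (BLeft 1)
  ltac:(by rewrite bnd_simp) ndk.
have cl : (f 1 + a * (s - 1))%:E @[s --> (0 : R)^'+] --> (f 1 + a * (0 - 1))%:E.
  apply: cvg_EFin; first exact: nearW.
  apply: cvg_at_right_filter; apply: cvgD; first exact: cvg_cst.
  by apply: cvgM; [exact: cvg_cst|apply: cvgB; [exact: cvg_id|exact: cvg_cst]].
have E : (fun s => (f s)%:E) = (fun s => (EFin \o k)
  s + (f 1 + a * (s - 1))%:E)%E.
  by apply/funext => s; rewrite /= -EFinD /k subrK.
rewrite /ext0 eqxx; apply/cvg_ex; rewrite E.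
by eexists; apply: cvgeD ck cl; rewrite fin_num_adde_defl.
Qed.

Lemma supporting_line_ext0 a t0 t :
  (forall t, 0 < t -> f t0 + a * (t - t0) <= f t) ->
  0 <= t -> ((f t0 + a * (t - t0))%:E <= ext0 f t)%E.
Proof.
move=> aP; rewrite le_eqVlt => /orP[/eqP <-|t_gt0];
  last by rewrite ext0_pos// lee_fin aP.
have cl : (f t0 + a * (s - t0))%:E @[s --> (0 : R)^'+] -->
  (f t0 + a * (0 - t0))%:E.
  apply: cvg_EFin; first exact: nearW.
  apply: cvg_at_right_filter; apply: cvgD; first exact: cvg_cst.
  by apply: cvgM; [exact: cvg_cst|apply: cvgB; [exact: cvg_id|exact: cvg_cst]].
apply: (lee_cvg_to cl cvg_ext0); near=> s; rewrite lee_fin; apply: aP.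
by near: s; exact: nbhs_right_gt.
Unshelve. all: by end_near. Qed.

(** The convexity of f matters: it ensures that the limit defining ext0 at 0
exists. *)
Lemma ext0N t : ext0 (fun s => - f s) t = (- ext0 f t)%E.
Proof.
rewrite {1}/ext0; case: eqP => [->|/eqP t0]; last by rewrite /ext0 (negbTE t0).
by apply/cvg_lim => //; under eq_fun do rewrite EFinN; exact: cvgeN cvg_ext0.
Qed.

End convex_half_line.

Section jensen.
Local Open Scope ereal_scope.
Context d (T : measurableType d) (R : realType).
Variable mu : {measure set T -> \bar R}.
Variables (p q : T -> R).
Hypotheses (p0 : forall x, (0 < p x)%R) (q0 : forall x, (0 <= q x)%R).
Hypotheses (ip : mu.-integrable setT (EFin \o p))
  (ipq : mu.-integrable setT (fun x => (p x * q x)%:E)).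

Let P := fine (\int[mu]_x (p x)%:E).
Let I := fine (\int[mu]_x (p x * q x)%:E).
Hypothesis P0 : (0 < P)%R.

Let PE : \int[mu]_x (p x)%:E = P%:E.
Proof. by rewrite fineK//; exact: integrable_fin_num ip. Qed.

Let IE : \int[mu]_x (p x * q x)%:E = I%:E.
Proof. by rewrite fineK//; exact: integrable_fin_num ipq. Qed.

Lemma integral_weight_cst (c : \bar R) : \int[mu]_x ((p x)%:E * c) = P%:E * c.
Proof.
have muT : 0 < mu setT.
  rewrite lt0e measure_ge0 andbT; apply/eqP => mu0.
  have Pz : P = 0%R by rewrite /P null_set_integral//; exact: measurable_int ip.
  by move: P0; rewrite Pz ltxx.
case: c => [c| |].
- by under eq_integral do rewrite muleC; rewrite (integralZl measurableT ip)
  PE muleC.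
- rewrite (eq_integral (cst +oo)); last by move=> x _;
  rewrite gt0_muley// lte_fin.
  by rewrite integral_cst// gt0_mulye// gt0_muley// lte_fin.
- rewrite (eq_integral (cst -oo)); last by move=> x _;
  rewrite gt0_muleNy// lte_fin.
  by rewrite integral_cst// gt0_mulNye// gt0_muleNy// lte_fin.
Qed.

(** If the mean I / P is positive, the supporting line there is integrated
against the weight p. If it is 0, then q = 0 almost everywhere and both sides
equal P * ext0 f 0. *)
Lemma jensen_ext0 (f : R -> R) :
  (convex_function (`]0, +oo[%classic : set R) f)%R ->
  mu.-integrable setT (fun x => (p x)%:E * ext0 f (q x)) ->
  ext0 f (I / P) * P%:E <= \int[mu]_x ((p x)%:E * ext0 f (q x)).
Proof.
move=> cf iF; have I0 : (0 <= I)%R.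
  by apply/fine_ge0/integral_ge0 => x _; rewrite lee_fin mulr_ge0// ltW.
move: I0; rewrite le_eqVlt => /orP[/eqP I0|I0].
  rewrite -I0 mul0r muleC -integral_weight_cst.
  rewrite le_eqVlt; apply/orP; left; apply/eqP/ae_eq_integral => //.
  - under eq_fun do rewrite muleC; apply: measurable_funeM.
    exact: measurable_int ip.
  - exact: measurable_int iF.
  have : \int[mu]_x `|(p x * q x)%:E| = 0.
    under eq_integral do rewrite gee0_abs ?lee_fin ?mulr_ge0 ?(ltW (p0 _))//.
    by rewrite IE -I0.
  move=> /(ae_eq_integral_abs _ measurableT (measurable_int _ ipq)).
  apply: filterS => x /(_ Logic.I) /eqP; rewrite eqe mulf_eq0 gt_eqF//= =>
    /eqP qx _.
  by rewrite qx.
have t0 : (0 < I / P)%R by rewrite divr_gt0.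
have [a aP] := supporting_line cf t0; set t := (I / P)%R in t0 aP *.
rewrite (ext0_pos f t0).
have i1 : mu.-integrable setT (fun x => (f t - a * t)%:E * (p x)%:E)
  by exact: integrableZl.
have i2 : mu.-integrable setT (fun x => a%:E * (p x * q x)%:E)
  by exact: integrableZl.
have E : (f t)%:E * P%:E =
    \int[mu]_x ((f t - a * t)%:E * (p x)%:E + a%:E * (p x * q x)%:E).
  rewrite integralD// !integralZl// PE IE -!EFinM -EFinD; congr (_%:E).
  by rewrite /t; field; rewrite gt_eqF.
rewrite E; apply: le_integral => //; first exact: integrableD.
move=> x _; rewrite (_ : _ + _ = (p x)%:E * (f t + a * (q x - t))%:E).
  by apply: lee_wpmul2l; [rewrite lee_fin ltW|exact: supporting_line_ext0].
by rewrite -!EFinM -EFinD; congr (_%:E); ring.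
Qed.

End jensen.

(** * Log-concave densities *)

Section log_density.
Context {R : realType} (n : nat) (phi : 'rV[R]_n -> R).
Hypotheses (phi0 : forall x, 0 < phi x) (C2 : C2_on setT phi).

Let psi x := - ln (phi x).

Let dphi x i : is_derive x (delta_mx 0 i) phi (partial i phi x).
Proof. by have [_ /(_ i)[d _ _]] := C2 (I : setT x); exact: derivableP. Qed.

Let d2phi x i j :
  is_derive x (delta_mx 0 j) (partial i phi) (partial j (partial i phi) x).
Proof. by have [_ /(_ i)[_ _ /(_ j)[d _]]] := C2 (I : setT x);
  exact: derivableP. Qed.

Let dpsi x i : is_derive x (delta_mx 0 i) psi (- (phi x)^-1 * partial i phi x).
Proof.
apply: (is_derive_comp_dir (F := fun t => - ln t)) => //.
have := is_deriveN (is_derive1_ln (phi0 x)); exact.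
Qed.

Lemma grad_ln x i : grad psi x 0 i = - (phi x)^-1 * partial i phi x.
Proof. by rewrite mxE; apply: derive_val. Qed.

Lemma is_derive_neg_ln x i : is_derive x (delta_mx 0 i) psi (grad psi x 0 i).
Proof. by rewrite grad_ln; exact: dpsi. Qed.

Lemma continuous_neg_ln : continuous psi.
Proof.
apply: continuous_rV => z J F FF u uz; have [cphi _] := C2 (I : setT z).
have cpu : phi (u t) @[t --> F] --> phi z by exact: (cvg_comp _ _ uz cphi).
rewrite /psi; apply: cvgN; apply: continuous_cvg => //; exact: continuous_ln.
Qed.

(** The second derivatives of - ln phi by the quotient rule. *)
Let M i j x := - (phi x)^-1 * partial j (partial i phi) x +
  partial i phi x * ((phi x) ^- 2 * partial j phi x).

Let d2psi x i j :
  is_derive x (delta_mx 0 j) (fun y => - (phi y)^-1 * partial i phi y)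
    (M i j x).
Proof.
apply: is_derive_mul => //.
apply: (is_derive_comp_dir (F := fun t => - t^-1)) => //.
have pn : phi x != 0 by rewrite gt_eqF.
have := is_deriveN (is_deriveV pn (is_derive_id (phi x) (1 : R))).
by rewrite scaleNr opprK /GRing.scale/= mulr1.
Qed.

Let HessE x i j : Hess psi x i j = M i j x.
Proof.
rewrite mxE (_ : partial i psi = fun y => - (phi y)^-1 * partial i phi y).
  exact: derive_val.
by apply/funext => y; have := grad_ln y i; rewrite mxE.
Qed.

Lemma grad_neg_ln_C1 : C1_map (grad psi) (Hess psi).
Proof.
have c0 : continuous phi by move=> x; have [] := C2 (I : setT x).
have c1 i : continuous (partial i phi).
  by move=> x; have [_ /(_ i)[]] := C2 (I : setT x).
have c2 i j : continuous (partial j (partial i phi)).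
  by move=> x; have [_ /(_ i)[_ _ /(_ j)[]]] := C2 (I : setT x).
split.
- move=> i; apply: continuous_rV => z J F FF u uz.
  under eq_fun do rewrite grad_ln; rewrite grad_ln.
  apply: cvgM; last exact: (cvg_comp _ _ uz (c1 i z)).
  apply: cvgN; apply: cvgV; [by rewrite gt_eqF|exact: (cvg_comp _ _ uz (c0 z))].
- move=> x i j; rewrite HessE (_ : (fun y => _) = fun y =>
  - (phi y)^-1 * partial i phi y).
    exact: d2psi.
  by apply/funext => y; rewrite grad_ln.
- move=> i j; apply: continuous_rV => z J F FF u uz.
  under eq_fun do rewrite HessE; rewrite HessE /M.
  have cv : (phi (u t))^-1 @[t --> F] --> (phi z)^-1.
    by apply: cvgV; [rewrite gt_eqF|exact: (cvg_comp _ _ uz (c0 z))].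
  apply: cvgD.
    by apply: cvgM; [exact: cvgN|exact: (cvg_comp _ _ uz (c2 i j z))].
  apply: cvgM; first exact: (cvg_comp _ _ uz (c1 i z)).
  apply: cvgM; last exact: (cvg_comp _ _ uz (c1 j z)).
  rewrite -exprVn expr2; under eq_fun do rewrite -exprVn expr2.
  exact: cvgM.
Qed.

Lemma div_arg_neg_ln x : div_arg phi x =
  expR (- dot (grad psi x) x) * phi x ^- 2 * \det (Hess psi x).
Proof.
rewrite /div_arg; congr (expR _ * _ * _).
rewrite /dot mulr_suml -sumrN; apply: eq_bigr => i _.
by rewrite grad_ln mxE; field; rewrite gt_eqF.
Qed.

End log_density.

Section quadratic.
Context {R : realType} (n : nat) (A : 'M[R]_n).
Implicit Types (x v : 'rV[R]_n).

Lemma is_derive_quad_form x v :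
  is_derive x v (quad_form A) (dot (x *m (A^T + A)) v).
Proof.
apply/is_deriveP.
have E : dot (x *m (A^T + A)) v + h * quad_form A v @[h --> (0 : R)^'] -->
    dot (x *m (A^T + A)) v + 0 * quad_form A v.
  apply: cvgD; first exact: cvg_cst.
  by apply: cvgMr_tmp; exact: cvg_within.
rewrite mul0r addr0 in E.
apply: cvg_trans E; apply: near_eq_cvg; near=> h.
have h0 : h != 0 by near: h; exact: nbhs_dnbhs_neq.
have -> : quad_form A (x + h *: v) =
    quad_form A x + h * dot (x *m (A^T + A)) v + h * (h * quad_form A v).
  rewrite /quad_form mulmxDl -scalemxAl mulmxDr !(dotDl, dotDr, dotZl, dotZr).
  by rewrite (dot_mulmx x v) trmxK [dot v _]dotC; ring.
by field.
Unshelve. all: by end_near. Qed.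

Lemma is_derive_mulmx (B : 'M[R]_n) x i j :
  is_derive x (delta_mx 0 j : 'rV[R]_n) (fun y => (y *m B) 0 i) (B j i).
Proof.
apply/is_deriveP.
have E : (fun=> B j i) @ (0 : R)^' --> B j i by exact: cvg_cst.
apply: cvg_trans E; apply: near_eq_cvg; near=> h.
have h0 : h != 0 by near: h; exact: nbhs_dnbhs_neq.
rewrite mulmxDl -scalemxAl -rowE mxE [(h *: row j B) 0 i]mxE [row j B 0 i]mxE.
by field.
Unshelve. all: by end_near. Qed.

(** Since <grad q, x> = 2 q x for the quadratic form q, the exponential factors
cancel and only the constant Hessian matrix A^T + A of q remains. *)
Lemma gaussian_div_arg (C : R) (phi : 'rV[R]_n -> R) : 0 < C ->
  (forall x, phi x = C * expR (- quad_form A x)) -> C2_on setT phi ->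
  forall x, div_arg phi x = C ^- 2 * \det (A^T + A).
Proof.
move=> C0 phiE C2 x.
have phi0 y : 0 < phi y by rewrite phiE mulr_gt0// expR_gt0.
rewrite (div_arg_neg_ln phi0 C2).
have lnE : (fun y => - ln (phi y)) = fun y => quad_form A y - ln C.
  apply/funext => y; rewrite phiE lnM ?posrE ?expR_gt0// expRK; ring.
have partialE i :
    partial i (fun y => - ln (phi y)) = fun y => (y *m (A^T + A)) 0 i.
  apply/funext => y; rewrite lnE /partial; apply: derive_val.
  rewrite -[X in is_derive _ _ _ X]dot_delta.
  rewrite -[X in is_derive _ _ _ X]subr0.
  apply: is_deriveB; exact: is_derive_quad_form.
have -> : grad (fun y => - ln (phi y)) x = x *m (A^T + A).
  by apply/rowP => i; rewrite mxE partialE.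
have -> : Hess (fun y => - ln (phi y)) x = A^T + A.
  apply/matrixP => i j; rewrite mxE partialE.
  transitivity ((A^T + A) j i); last by rewrite !mxE addrC.
  by apply: derive_val; exact: is_derive_mulmx.
have -> : dot (x *m (A^T + A)) x = quad_form A x + quad_form A x.
  by rewrite mulmxDr dotDl (dot_mulmx x x A) [dot x (_ *m _)]dotC.
rewrite phiE opprD expRD; set e := expR _.
have e0 : e != 0 by rewrite gt_eqF// expR_gt0.
by field; rewrite gt_eqF.
Qed.

End quadratic.

Section positive_integral.
Context {R : realType} (n : nat) (phi : 'rV[R]_n -> R).
Local Notation mu := (@lebesgue_rV R n).
Hypotheses (phi0 : forall x, 0 < phi x)
  (iphi : mu.-integrable setT (EFin \o phi)).

Lemma fine_integral_gt0 : 0 < fine (\int[mu]_x (phi x)%:E)%E.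
Proof.
rewrite lt_neqAle fine_ge0 ?andbT; last first.
  by apply: integral_ge0 => x _; rewrite lee_fin ltW.
apply/eqP => i0.
have iE : (\int[mu]_x (phi x)%:E = 0)%E.
  by rewrite -[LHS]fineK -?i0//; exact: integrable_fin_num iphi.
have : (\int[mu]_x `|(EFin \o phi) x| = 0)%E.
  by rewrite -[RHS]iE; apply: eq_integral => x _;
    rewrite gee0_abs// lee_fin ltW.
move=> /(ae_eq_integral_abs _ measurableT (measurable_int _ iphi))[N [mN N0
  sN]].
have TN : setT `<=` N.
  move=> x _; apply: sN => /(_ Logic.I) /eqP; rewrite /= eqe gt_eqF//.
have muT : mu setT = 0%E.
  by apply/eqP; rewrite -measure_le0 -N0; apply: le_measure; rewrite ?inE.
have : (mu (box 1) <= mu setT)%E.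
  by apply: le_measure; rewrite ?inE//; exact: measurable_box.
by rewrite muT lebesgue_rV_cube// lee_fin leNgt exprn_gt0.
Qed.

End positive_integral.

Section affine_convex.
Context {R : realType}.

Lemma affine_convex (f : R -> R) (a b : R) :
  (forall t, 0 < t -> f t = a * t + b) ->
  convex_function (`]0, +oo[%classic : set R) f.
Proof.
move=> fE t x y; rewrite !inE/= !in_itv/= !andbT => x0 y0.
rewrite !fE ?convR_gt0// !convRE le_eqVlt; apply/orP; left; apply/eqP.
rewrite [X in a * X](_ : _ = t%:num * (x : R) + (1 - t%:num) * (y : R))//.
by rewrite /unstable.onem; ring.
Qed.

End affine_convex.

Section dual_identity.
Context {R : realType} (n : nat) (phi : 'rV[R]_n -> R).
Hypotheses (phi0 : forall x, 0 < phi x) (C2 : C2_on setT phi)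
  (sc : strictly_convex (fun x => - ln (phi x))).
Local Notation mu := (@lebesgue_rV R n).

Let psi x := - ln (phi x).
Let dpsi := is_derive_neg_ln phi0 C2.
Let cpsi := continuous_neg_ln phi0 C2.
Let CG := grad_neg_ln_C1 phi0 C2.

Let phiE x : phi x = expR (- psi x).
Proof. by rewrite /psi opprK lnK// posrE. Qed.

Let reg0 : reg psi 0 = psi.
Proof. by apply/funext => x; rewrite /reg mul0r mul0r addr0. Qed.

Let pullbackE x :
  reg_pullback psi (grad psi) (Hess psi) 0 x = phi x * div_arg phi x.
Proof.
rewrite div_arg_neg_ln// /reg_pullback reg0 /reg_grad scale0r addr0.
rewrite (_ : reg_Hess _ 0 x = Hess psi x); last first.
  by apply/matrixP => i j; rewrite !mxE mul0rn addr0.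
rewrite -/psi [phi x]phiE -expRM_natl -expRN mulrA -!expRD; congr (expR _ * _).
by ring.
Qed.

Lemma div_arg_ge0 x : 0 <= div_arg phi x.
Proof.
rewrite -(pmulr_rge0 _ (phi0 x)) -pullbackE.
exact: (reg_pullback_ge0 sc dpsi CG).
Qed.

Lemma integral_div_arg :
  (\int[mu]_x (phi x * div_arg phi x)%:E = \int[mu]_y (dual phi y)%:E)%E.
Proof.
have := integral_dual_eq_pullback sc dpsi cpsi CG; rewrite /reg_dual reg0.
rewrite (_ : (fun x => expR (- psi x)) = phi); last by apply/funext => x;
  rewrite phiE.
by move=> ->; apply: eq_integral => x _; rewrite pullbackE.
Qed.

Lemma integrable_div_arg : mu.-integrable setT (EFin \o dual phi) ->
  mu.-integrable setT (fun x => (phi x * div_arg phi x)%:E).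
Proof.
move=> iD; apply/integrableP; split.
  under eq_fun do rewrite -pullbackE.
  apply/measurable_EFinP; apply: continuous_measurable_rV.
  exact: (continuous_reg_pullback cpsi CG).
rewrite (eq_integral (fun x => (phi x * div_arg phi x)%:E)); last first.
  by move=> x _; rewrite gee0_abs// lee_fin mulr_ge0 ?div_arg_ge0// ltW.
by rewrite integral_div_arg ltey_eq (integrable_fin_num measurableT iD).
Qed.

End dual_identity.

(** * The inequality *)

Theorem theorem1 (R : realType) (n : nat) (f : R -> R) (phi : 'rV[R]_n -> R)
    (mu := lebesgue_rV n)
    (LHS := (\int[mu]_(x in supp phi) div_integrand f phi x)%E)
    (RHS := (ext0 f ((\int[mu]_x dual phi x) / (\int[mu]_x phi x)) *
             \int[mu]_(x in supp phi) (phi x)%:E)%E) :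
  log_concave phi ->
  strictly_convex (fun x => - ln (phi x)) ->
  C2_on (supp phi) phi ->
  mu.-integrable setT (EFin \o phi) ->
  mu.-integrable (supp phi) (EFin \o dual phi) ->
  mu.-integrable (supp phi) (div_integrand f phi) ->
  [/\ convex_function (`]0, +oo[%classic : set R) f -> (RHS <= LHS)%E,
      convex_function (`]0, +oo[%classic : set R) (fun t => - f t) ->
        (LHS <= RHS)%E,
      (exists a b : R, forall t, 0 < t -> f t = a * t + b) -> LHS = RHS &
      convex_function (`]0, +oo[%classic : set R) f \/
      convex_function (`]0, +oo[%classic : set R) (fun t => - f t) ->
      forall (C : R) (A : 'M[R]_n), 0 < C -> posdefmx A ->
        (forall x, phi x = C * expR (- quad_form A x)) -> LHS = RHS].
Proof.
move=> [psi0 _ phiE] sc C2 iphi iD iF.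
have phi0 x : 0 < phi x by rewrite phiE expR_gt0.
have sE : supp phi = setT by apply/seteqP; split => // x _; exact: phi0.
rewrite sE in C2 iD iF LHS RHS *.
have P0 := fine_integral_gt0 phi0 iphi.
have q0 := div_arg_ge0 phi0 C2 sc.
have ipq := integrable_div_arg phi0 C2 sc iD.
have PE : (\int[mu]_x (phi x)%:E = (fine (\int[mu]_x (phi x)%:E))%:E)%E.
  by rewrite fineK//; exact: integrable_fin_num iphi.
have RHSE : RHS = (ext0 f (fine (\int[mu]_x (phi x * div_arg phi x)%:E)%E /
    fine (\int[mu]_x (phi x)%:E)%E) * (fine (\int[mu]_x (phi x)%:E)%E)%:E)%E.
  by rewrite /RHS -PE integral_div_arg.
have convexP : convex_function (`]0, +oo[%classic : set R) f -> (RHS <= LHS)%E.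
  by move=> cf; rewrite RHSE; exact: (jensen_ext0 phi0 q0 iphi ipq P0 cf iF).
have concaveP : convex_function (`]0, +oo[%classic : set R) (fun t => - f t) ->
    (LHS <= RHS)%E.
  move=> cf.
  have fN : f = fun t => - - f t by apply/funext => t; rewrite opprK.
  have extN t : ext0 (fun t => - f t) t = (- ext0 f t)%E.
    by rewrite {2}fN (ext0N cf) oppeK.
  have FN : (fun x => (phi x)%:E * ext0 (fun t => - f t)%R (div_arg phi x))%E =
      (fun x => - div_integrand f phi x)%E.
    by apply/funext => x; rewrite extN muleN.
  have iFN : mu.-integrable setT (fun x => - div_integrand f phi x)%E.
    exact: integrableN.
  rewrite -FN in iFN.
  have := jensen_ext0 phi0 q0 iphi ipq P0 cf iFN.
  rewrite extN mulNe -RHSE FN integralN; first by rewrite leeN2.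
  exact: integrable_add_def.
split => //.
- move=> [a [b fE]]; apply/eqP; rewrite eq_le; apply/andP; split.
    apply/concaveP/(@affine_convex _ _ (- a) (- b)) => t t0.
    by rewrite fE// mulNr opprD.
  by apply/convexP/(@affine_convex _ _ a b).
- move=> _ C A C0 _ phiG.
  have divE := gaussian_div_arg C0 phiG C2.
  set k := C ^- 2 * _ in divE.
  have tE : fine (\int[mu]_x (phi x * div_arg phi x)%:E)%E /
      fine (\int[mu]_x (phi x)%:E)%E = k.
    under eq_integral do rewrite divE EFinM.
    rewrite (integral_weight_cst phi0 iphi P0) -EFinM/=.
    by rewrite [_ * k]mulrC mulfK ?gt_eqF.
  rewrite RHSE tE /LHS /div_integrand; under eq_integral do rewrite divE.
  by rewrite (integral_weight_cst phi0 iphi P0) muleC.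
Qed.
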